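(* Let $p\in(0,1)$. For $((s,t),r)$ with $0\le r<s<\infty$ and $t\in\mathbb R_+$, the following $\mathbb R_+$-valued limit exists: $$-\lim_{N\to\infty}N^{-1}\log\mathbb P\{G_{\lfloor Ns\rfloor,\lfloor Nt\rfloor}\ge Nr\}=J_{s,t}(r).$$ As a function of $((s,t),r)$, $J_{s,t}(r)$ is a continuous convex function on the interior of the set $A=\{((s,t),r): s\ge r\vee 0,\ t\in\mathbb R_+,\ r\in\mathbb R_+\}$, and it can be uniquely extended (from the interior) to a finite continuous convex function on the closure $\bar A$. Moreover, $J_{s,t}(r)>0$ for $r>g_{pp}(s,t)$.
   Context: Here $\mathbb R_+=[0,\infty)$ and $\mathbb Z_+=\{0,1,2,\dots\}$. Let $\{\omega_v\}_{v\in\mathbb Z_+^2}$ be i.i.d. Bernoulli($p$) random variables with values in $\{0,1\}$ and $\mathbb P\{\omega_v=1\}=p$. An admissible path from $v$ to $w$ is a sequence $v=v_0,v_1,\dots,v_k=w$ in $\mathbb Z_+^2$ with $v_{i+1}-v_i\in\{e_1,e_2\}$. The last passage time is $$G_{v,w}=\max_{\pi}\sum_{i}\omega_{v_{i+1}}\mathbf 1\{v_{i+1}-v_i=e_1\},$$ the maximum over admissible paths from $v$ to $w$ (weights are collected only through horizontal steps), and $G_{m,n}=G_{(0,0),(m,n)}$. The law of large numbers limit of $N^{-1}G_{\lfloor Ns\rfloor,\lfloor Nt\rfloor}$ is $g_{pp}(s,t)=\big(\sqrt{ps}+\sqrt{(1-p)t}\big)^2-t$ if $t<s\frac{1-p}{p}$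 and $g_{pp}(s,t)=s$ if $t\ge s\frac{1-p}{p}$. *)

(* Defs.v *)
From HB Require Import structures.
From mathcomp Require Import all_boot all_order all_algebra.
From mathcomp Require Import all_classical all_reals all_analysis.
Import Order.TTheory GRing.Theory Num.Theory.
Import numFieldNormedType.Exports.

Set Implicit Arguments.
Unset Strict Implicit.
Unset Printing Implicit Defensive.

Local Open Scope classical_set_scope.
Local Open Scope ring_scope.

Section Independence.
Context {d d'} {T : measurableType d} {T' : measurableType d'} {R : realType}.
Variable P : probability T R.

Definition mutually_independent (I : choiceType) (X : I -> {RV P >-> T'}) :=
  forall (s : seq I) (B : I -> set T'), uniq s ->
    (forall i, measurable (B i)) ->
    P (\bigcap_(i in [set` s]) X i @^-1` B i) =
    (\prod_(i <- s) P (X i @^-1` B i))%E.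

End Independence.
Arguments mutually_independent {d d' T T' R} P {I} X.

Section LastPassage.
Implicit Types (u v w : nat * nat) (pi : seq (nat * nat)).
Implicit Type om : nat * nat -> bool.

Definition hstep u v := v == (u.1.+1, u.2).
Definition vstep u v := v == (u.1, u.2.+1).

(* The path v = v_0, v_1, ..., v_k = w is encoded by its first point v and the
   sequence pi = [:: v_1; ...; v_k]. *)
Definition admissible v w : set (seq (nat * nat)) :=
  [set pi | path [rel x y | hstep x y || vstep x y] v pi /\ last v pi = w].

(* zip (v :: pi) pi lists the pairs (v_i, v_{i+1}). *)
Definition passage_time om v pi : nat :=
  (\sum_(e <- zip (v :: pi) pi | hstep e.1 e.2) om e.2)%N.

(* The supremum is a maximum as soon as an admissible path exists: see
   last_passage_max. *)
Definition last_passage (R : realType) om v w : R :=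
  sup [set (passage_time om v pi)%:R | pi in admissible v w].

Lemma passage_time_le om v w pi :
  admissible v w pi -> (passage_time om v pi + v.1 <= w.1)%N.
Proof.
case; elim: pi v => [|u pi IH] v /=.
  by move=> _ <-; rewrite /passage_time /= big_nil add0n.
move=> /andP[vu upi] lw; have := IH u upi lw.
rewrite /passage_time /= big_cons /= => h; apply: leq_trans h.
case: ifPn => [/eqP -> /=|nh].
  by case: (om _) => /=; rewrite ?add1n ?add0n ?addSn ?addnS.
by move: vu; rewrite (negbTE nh) /= => /eqP -> /=.
Qed.

Lemma last_passage_max (R : realType) om v w :
  admissible v w !=set0 ->
  exists2 pi, admissible v w pi &
    last_passage R om v w = (passage_time om v pi)%:R /\
    forall pi', admissible v w pi' ->
      (passage_time om v pi' <= passage_time om v pi)%N.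
Proof.
move=> [pi0 a0].
pose Q n := `[< exists2 pi, admissible v w pi & passage_time om v pi = n >].
have exQ : exists n, Q n.
  by exists (passage_time om v pi0); apply/asboolP; exists pi0.
have leQ n : Q n -> (n <= w.1)%N.
  move=> /asboolP[pi api <-]; apply: leq_trans (passage_time_le om api).
  exact: leq_addr.
case: (ex_maxnP exQ leQ) => n /asboolP[pi api en] nmax.
have pimax pi' : admissible v w pi' ->
    (passage_time om v pi' <= passage_time om v pi)%N.
  by move=> api'; rewrite en; apply: nmax; apply/asboolP; exists pi'.
exists pi => //; split=> //.
have ub : ubound [set (passage_time om v pi')%:R | pi' in admissible v w]
    ((passage_time om v pi)%:R : R).
  by move=> _ [pi' /pimax h <-]; rewrite ler_nat.
apply/eqP; rewrite eq_le; apply/andP; split.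
  by apply: ge_sup => //; exists (passage_time om v pi)%:R; exists pi.
apply: ub_le_sup; first by exists ((passage_time om v pi)%:R : R).
by exists pi.
Qed.

End LastPassage.

(* The point x encodes ((s, t), r) = ((x.1.1, x.1.2), x.2).  The copies R^o
   of R carry the module structure required by convex_function. *)
Definition rate_domain (R : realType) : set (R^o * R^o * R^o) :=
  [set x | Num.max x.2 0 <= x.1.1 /\ 0 <= x.1.2 /\ 0 <= x.2].

Arguments rate_domain R : clear implicits.

Definition gpp (R : realType) (p s t : R) : R :=
  if t < s * ((1 - p) / p)
  then (Num.sqrt (p * s) + Num.sqrt ((1 - p) * t)) ^+ 2 - t
  else s.

Definition convex_extension (R : realType) (A : set (R^o * R^o * R^o))
    (f g : R^o * R^o * R^o -> R^o) :=
  [/\ forall x, A° x -> g x = f x, {within closure A, continuous g} &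
      convex_function (closure A) g].

(* Main.v *)
Require Import Defs.
From HB Require Import structures.
From mathcomp Require Import all_boot all_order all_algebra.
From mathcomp Require Import all_classical all_reals all_analysis.
From mathcomp Require Import zify ring lra.
Import Order.TTheory GRing.Theory Num.Theory.
Import numFieldNormedType.Exports.

Local Open Scope classical_set_scope.
Local Open Scope ring_scope.

(** Why the theorem is true.

    Existence and convexity.  Last passage values are superadditive: paths can
    be concatenated ([lpp_superadd]), and the two pieces read weights in disjoint
    sets of columns.  With independence and translation invariance the tail
    [Q(m, n, y) = P(G >= y)] is supermultiplicative in [(m, n, y)]
    ([tail_supermul]); it is also monotone in each variable, and at least
    [p ^+ m] when [y <= m] ([tail_ge]).  Monotonicity absorbs the roundings, so
    [- ln Q] along [(N s, N t, N r)] is subadditive in [N] and Fekete's lemma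
    gives the limit ([rate_cvg]).  Subadditivity in all variables at once makes
    the limit subadditive and positively homogeneous, hence convex, on the cone
    [0 <= s, 0 <= t, r < s] ([rate_subadd], [rate_scale]).  It is between 0 and
    [- ln p * s].

    Extension.  On the closed cone the limit is extended by approaching a
    point from the direction [(1, 1, 0)], along which the rate is monotone.
    Subadditivity and the linear bound control oscillations: moving from [x'] to
    [x] costs at most the bound at [x - (1 - q) * x'], provided that this point
    lies in the cone, which holds near [x'] because the cone is polyhedral
    ([fbar_continuous]).  Uniqueness is density of the interior.

    Positivity.  From one row to the next, the horizontal increments of the lower
    row act as the services of a discrete-time queue, the weights of the upper
    row as its arrivals and the vertical increments as its length; the horizontal
    increments of the upper row mark the arrivals and the unused services.  With
    arrivals Bernoulli([p]) and services Bernoulli([u]), [u > p], the stationary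
    length is geometric, and in equilibrium the increments of the upper row are
    again i.i.d. Bernoulli([u]) (Burke's theorem, [burke]).  Comparing empty initial queues with equilibrium
    ones at the price of a factor [z] per customer bounds the exponential moment
    of [G] by a product with [m] Bernoulli and [n.+1] geometric factors
    ([row_mgf_le]).  Markov's inequality then shows exponential decay of the tail
    as soon as [r] exceeds the stationary mean
    [s * u + t * (p * (1 - u) / (u - p))] for some [u] ([rate_gt0]), and the
    infimum of this mean over [u] is [gpp] ([gpp_parameter]).  As the mean is
    linear in [(s, t)], the strict inequality survives small shifts of [(s, t)],
    which transfers positivity to the boundary. *)

(** * Last passage values as a recursion *)

Section Combinatorics.
Local Open Scope nat_scope.
Implicit Types (o : nat * nat -> bool) (U w : seq bool).

(** The nested recursion is the dynamic programming equation read off the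
    last step of a path; it turns the supremum over paths into a function on
    which induction on the endpoint is possible. *)
Fixpoint lpp o (m : nat) : nat -> nat :=
  if m is m'.+1 then
    fix column n :=
      if n is n'.+1 then maxn (lpp o m' n + o (m, n)) (column n')
      else lpp o m' 0 + o (m, 0)
  else fun=> 0.

Lemma lppS0 o m : lpp o m.+1 0 = lpp o m 0 + o (m.+1, 0).
Proof. by []. Qed.

Lemma lppSS o m n :
  lpp o m.+1 n.+1 = maxn (lpp o m n.+1 + o (m.+1, n.+1)) (lpp o m.+1 n).
Proof. by []. Qed.

Lemma lpp_ge_hstep o m n : lpp o m n + o (m.+1, n) <= lpp o m.+1 n.
Proof. by case: n => [|n]; rewrite ?lppSS ?leq_maxl. Qed.

Lemma lpp_ge_vstep o m n : lpp o m n <= lpp o m n.+1.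
Proof. by case: m => [|m] //; rewrite lppSS leq_maxr. Qed.

(** Concatenating an optimal path to [(m, n)] with an optimal path between
    [(m, n)] and [(m + m', n + n')] gives an admissible path.  The second
    passage time reads only weights in columns beyond [m], the first one only
    weights in columns up to [m]; this is the source of independence later. *)
Lemma lpp_superadd o m n m' n' :
  lpp o m n + lpp (fun v => o (m + v.1, n + v.2)) m' n' <= lpp o (m + m') (n + n').
Proof.
elim: m' n' => [|m' IHm] n'.
  rewrite addn0 [X in _ + X](_ : _ = 0) // addn0.
  elim: n' => [|n' IHn]; first by rewrite addn0.
  by rewrite addnS; apply: leq_trans IHn (lpp_ge_vstep _ _ _).
elim: n' => [|n' IHn].
  rewrite lppS0 addnA /= addnS; apply: leq_trans (lpp_ge_hstep _ _ _).
  by rewrite leq_add2r IHm.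
rewrite lppSS addn_maxr geq_max; apply/andP; split.
  rewrite addnA /= (addnS m); apply: leq_trans (lpp_ge_hstep _ _ _).
  by rewrite leq_add2r IHm.
by apply: leq_trans IHn _; rewrite (addnS n) lpp_ge_vstep.
Qed.

Lemma leq_lpp o m n m' n' : m <= m' -> n <= n' -> lpp o m n <= lpp o m' n'.
Proof.
move=> /subnKC <- /subnKC <-; apply: leq_trans (lpp_superadd _ _ _ _ _).
exact: leq_addr.
Qed.

Lemma eq_lpp o o' m n :
  (forall i j, 0 < i <= m -> j <= n -> o (i, j) = o' (i, j)) ->
  lpp o m n = lpp o' m n.
Proof.
elim: m n => [//|m IHm] n.
elim: n => [|n IHn] eqo.
  rewrite !lppS0 (IHm 0) => [|i j ? ?]; first by rewrite eqo ?leqnn.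
  by apply: eqo => //; lia.
rewrite !lppSS (IHm n.+1) => [|i j ? ?]; last by apply: eqo => //; lia.
rewrite IHn => [|i j ? ?]; last by apply: eqo => //; lia.
by rewrite eqo ?leqnn.
Qed.

Let step := [rel x y : nat * nat | hstep x y || vstep x y].

Lemma passage_time_rcons o v pi (u : nat * nat) : passage_time o v (rcons pi u) =
  passage_time o v pi + (hstep (last v pi) u && o u).
Proof.
rewrite /passage_time; elim: pi v => [|u' pi IH] v /=.
  by rewrite big_nil big_cons big_nil /=; case: ifP; rewrite ?addn0 ?add0n.
by rewrite !big_cons IH; case: ifP => // _; rewrite addnA.
Qed.

(** Paths are extended at their last point, so that the induction follows the
    recursion defining [lpp]. *)
Lemma passage_time_le_lpp o pi : path step (0, 0) pi ->
  passage_time o (0, 0) pi <= lpp o (last (0, 0) pi).1 (last (0, 0) pi).2.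
Proof.
elim/last_ind: pi => [|pi [m n] IH]; first by rewrite /passage_time big_nil.
rewrite rcons_path last_rcons passage_time_rcons => /andP[/IH {IH}].
case: (last _ pi) => i j /= le_pi /orP[|]; rewrite /hstep /vstep /=.
  move=> /eqP[-> ->]; rewrite eqxx /=.
  by apply: leq_trans (lpp_ge_hstep _ _ _); rewrite leq_add2r.
move=> /eqP[-> ->]; rewrite xpair_eqE eqn_leq ltnn andbF /= addn0.
exact: leq_trans le_pi (lpp_ge_vstep _ _ _).
Qed.

Lemma lpp_attained o m n : exists2 pi, admissible (0, 0) (m, n) pi &
  passage_time o (0, 0) pi = lpp o m n.
Proof.
have extend i j i' j' pi : admissible (0, 0) (i, j) pi -> step (i, j) (i', j') ->
    admissible (0, 0) (i', j') (rcons pi (i', j')).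
  by move=> [pth lst] st; split; rewrite ?last_rcons // rcons_path pth lst.
have hext i j pi : admissible (0, 0) (i, j) pi ->
    passage_time o (0, 0) (rcons pi (i.+1, j)) =
    passage_time o (0, 0) pi + o (i.+1, j).
  by move=> [_ lst]; rewrite passage_time_rcons lst /hstep eqxx.
have vext i j pi : admissible (0, 0) (i, j) pi ->
    passage_time o (0, 0) (rcons pi (i, j.+1)) = passage_time o (0, 0) pi.
  move=> [_ lst]; rewrite passage_time_rcons lst /hstep /= xpair_eqE.
  by rewrite eqn_leq ltnn andbF addn0.
elim: m n => [|m IHm] n.
  elim: n => [|n [pi adm pt]].
    by exists [::]; rewrite ?/admissible //= /passage_time big_nil.
  exists (rcons pi (0, n.+1)); last by rewrite vext // pt.
  by apply: extend adm _; apply/orP; right; apply: eqxx.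
elim: n => [|n [pi adm pt]].
  have [pi adm pt] := IHm 0; exists (rcons pi (m.+1, 0)); last by rewrite hext // pt.
  by apply: extend adm _; apply/orP; left; apply: eqxx.
rewrite lppSS; case: leqP => _.
  exists (rcons pi (m.+1, n.+1)); last by rewrite vext // pt.
  by apply: extend adm _; apply/orP; right; apply: eqxx.
have [pi' adm' pt'] := IHm n.+1.
exists (rcons pi' (m.+1, n.+1)); last by rewrite hext // pt'.
by apply: extend adm' _; apply/orP; left; apply: eqxx.
Qed.

Lemma last_passage_lpp (R : realType) o m n :
  last_passage R o (0, 0) (m, n) = (lpp o m n)%:R%R.
Proof.
have [pi0 adm0 pt0] := lpp_attained o m n.
have [|pi [adm lst] [-> pimax]] := @last_passage_max R o (0, 0) (m, n).
  by exists pi0.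
congr (_%:R)%R; apply/eqP; rewrite eqn_leq -{2}pt0 pimax // andbT.
by apply: leq_trans (passage_time_le_lpp _ _ adm) _; rewrite lst.
Qed.

(** ** Row increments: a discrete-time queue *)

(** One row of the recursion, expressed through increments.  [U] lists the
    horizontal increments (0 or 1) of the row below, [w] the weights of the new
    row, and [v] is the vertical increment at the left end.  In a cell with
    bottom increment [a], left increment [v] and weight [b], the maximum in the
    recursion yields the top increment [max(b, a - v)] and the right increment
    [max(v + b - a, 0)].  So [v] behaves as the length of a queue with arrivals
    [b] and services [a]; a top increment is 1 when there is an arrival or an
    unused service. *)
Fixpoint scan v U w : seq bool :=
  match U, w with
  | a :: U', b :: w' => (b || a && (v == 0)) :: scan (v + b - a) U' w'
  | _, _ => [::]
  end.

Lemma size_scan v U w : size U = size w -> size (scan v U w) = size w.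
Proof. by elim: U v w => [|a U IH] v [|b w] //= [/IH ->]. Qed.

(** In every cell the bottom and right increments have the same sum as the left
    and top ones, so the vertical increment before the last cell is [v] plus the
    sum of the top increments minus that of the bottom ones. *)
Lemma scan_rcons v U w a b : size U = size w ->
  scan v (rcons U a) (rcons w b) =
  rcons (scan v U w) (b || a && (v + count id (scan v U w) <= count id U)).
Proof.
elim: U v w => [|a' U IH] v [|b' w] //=; first by rewrite addn0 leqn0.
move=> [sz]; rewrite IH //; congr (_ :: rcons _ (_ || _ && _)).
by case: a' b' v => [] [] [|v] /=; lia.
Qed.

Lemma scan_nseq_false v w : scan v (nseq (size w) false) w = w.
Proof. by elim: w v => //= b w IH v; rewrite orbF IH. Qed.

(** Increments are compared through the height profiles that they generate
    from the starting heights [h] and [h']. *)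
Fixpoint below h U h' U' : bool :=
  (h <= h') && match U, U' with
  | a :: U1, a' :: U1' => below (h + a) U1 (h' + a') U1'
  | _, _ => true
  end.

Lemma below_count h U h' U' : size U = size U' -> below h U h' U' ->
  h + count id U <= h' + count id U'.
Proof.
elim: U U' h h' => [|a U IH] [|a' U'] h h' //=; first by rewrite andbT !addn0.
by move=> [sz] /andP[_ /IH]; rewrite !addnA; apply.
Qed.

Lemma below_refl h U : below h U h U.
Proof. by elim: U h => [|a U IH] h /=; rewrite leqnn /=. Qed.

Lemma below_nseq_false h n U : below h (nseq n false) h U.
Proof.
suff H h' : h <= h' -> below h (nseq n false) h' U by exact: H.
elim: n U h' => [|n IH] [|a U] h' hh' /=; rewrite hh' //=.
by rewrite addn0 IH // (leq_trans hh') // leq_addr.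
Qed.

(** The recursion is monotone in the heights of the row below and in the
    height at the left end. *)
Lemma scan_below h U h' U' v v' w : size U = size w -> size U' = size w ->
  below h U h' U' -> h + v <= h' + v' ->
  below (h + v) (scan v U w) (h' + v') (scan v' U' w).
Proof.
elim: w U U' h h' v v' => [|b w IH] [|a U] [|a' U'] h h' v v' //=.
  by rewrite !andbT.
move=> [szU] [szU'] /andP[hh' bl] hv; rewrite hv /=.
(* Top and left increments add up to right and bottom increments around a cell. *)
have cell k x c : k + x + (b || c && (x == 0)) = k + c + (x + b - c).
  by case: b c x => [] [] [|x] /=; lia.
have hh1 : h + a <= h' + a' by case: (U) (U') bl => [|? ?] [|? ?] /= /andP[].
rewrite !cell; apply: IH => //.
by case: b a a' {cell bl} hh1 => [] [] []; lia.
Qed.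

Definition weight_row o m j := mkseq (fun i => o (i.+1, j)) m.

(** Index [j] stands for the row below row [j]: starting from an additional
    row of zero increments makes row 0 an instance of [scan] as well. *)
Fixpoint increments o m j : seq bool :=
  if j is j'.+1 then scan 0 (increments o m j') (weight_row o m j')
  else nseq m false.

Lemma weight_rowS o m j : weight_row o m.+1 j = rcons (weight_row o m j) (o (m.+1, j)).
Proof. by rewrite /weight_row /mkseq -[in iota _ _]addn1 iotaD map_cat cats1. Qed.

Lemma size_increments o m j : size (increments o m j) = m.
Proof. by elim: j => [|j IH] /=; rewrite ?size_nseq ?size_scan ?size_mkseq. Qed.

Lemma increments1 o m : increments o m 1 = weight_row o m 0.
Proof. by rewrite /= -{1}(size_mkseq (fun i => o (i.+1, 0)) m) scan_nseq_false. Qed.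

Lemma eq_increments o o' m j :
  (forall i j', j' < j -> o (i, j') = o' (i, j')) ->
  increments o m j = increments o' m j.
Proof.
elim: j => [//|j IH] eqo /=; rewrite IH => [|i j' ltj]; last by apply: eqo; lia.
by congr scan; apply: eq_map => i; apply: eqo.
Qed.

Lemma count_increments o m n : count id (increments o m n.+1) = lpp o m n.
Proof.
elim: m n => [|m IHm] n.
  by move: (count_size id (increments o 0 n.+1)); rewrite size_increments leqn0 => /eqP.
have [d -> ->] : exists2 d : bool,
    increments o m.+1 n.+1 = rcons (increments o m n.+1) d &
    lpp o m.+1 n = lpp o m n + d; last first.
  by rewrite -cats1 count_cat IHm /= addn0.
elim: n => [|n [d incE lppE]].
  by exists (o (m.+1, 0)); rewrite ?increments1 ?weight_rowS.
have -> : increments o m.+1 n.+2 =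
    scan 0 (increments o m.+1 n.+1) (weight_row o m.+1 n.+1) by [].
rewrite incE weight_rowS lppSS lppE scan_rcons ?size_increments ?size_mkseq //.
eexists; first reflexivity.
rewrite -[scan _ _ _]/(increments o m n.+2) !IHm add0n.
have := lpp_ge_vstep o m n; case: (o _) => /=; first by lia.
by case: d {incE lppE} => /=; lia.
Qed.

End Combinatorics.

(** * Expectations over finitely many Bernoulli variables *)

Section BernoulliExpectation.
Context {R : realType}.
Implicit Types (p : R) (n : nat) (F G : seq bool -> R).

Fixpoint Ebern p n F : R :=
  if n is n'.+1 then p * Ebern p n' (fun w => F (true :: w))
                     + (1 - p) * Ebern p n' (fun w => F (false :: w))
  else F [::].

Lemma eq_Ebern p n F G : (forall w, size w = n -> F w = G w) ->
  Ebern p n F = Ebern p n G.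
Proof.
elim: n F G => [|n IH] F G FG /=; first exact: FG.
by congr (_ * _ + _ * _); apply: IH => w sz; rewrite FG //= sz.
Qed.

Lemma le_Ebern p n F G : 0 <= p <= 1 -> (forall w, size w = n -> F w <= G w) ->
  Ebern p n F <= Ebern p n G.
Proof.
move=> /andP[p0 p1]; elim: n F G => [|n IH] F G FG /=; first exact: FG.
by apply: lerD; apply: ler_wpM2l; rewrite ?subr_ge0 //; apply: IH => w sz;
  apply: FG; rewrite /= sz.
Qed.

Lemma Ebern_linear p n a b F G :
  Ebern p n (fun w => a * F w + b * G w) = a * Ebern p n F + b * Ebern p n G.
Proof. by elim: n F G => [|n IH] F G //=; rewrite !IH; ring. Qed.

Lemma EbernZ p n a F : Ebern p n (fun w => a * F w) = a * Ebern p n F.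
Proof. by elim: n F => [|n IH] F //=; rewrite !IH; ring. Qed.

Lemma Ebern_cst p n a : Ebern p n (fun=> a) = a.
Proof. by elim: n => [|n IH] //=; rewrite !IH; ring. Qed.

Lemma Ebern_ge0 p n F : 0 <= p <= 1 -> (forall w, size w = n -> 0 <= F w) ->
  0 <= Ebern p n F.
Proof. by move=> p01 F0; rewrite -[leLHS](Ebern_cst p n); apply: le_Ebern. Qed.

Lemma Ebern_cat p m n F :
  Ebern p (m + n) F = Ebern p m (fun w => Ebern p n (fun w' => F (w ++ w'))).
Proof. by elim: m F => [|m IH] F //=; rewrite !IH. Qed.

Lemma Ebern_expn p n (z : R) :
  Ebern p n (fun w => z ^+ count id w) = (1 - p + p * z) ^+ n.
Proof.
elim: n => [|n IH] /=; first by rewrite !expr0.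
under [X in p * X]eq_Ebern do rewrite exprD expr1.
under [X in (1 - p) * X]eq_Ebern do rewrite add0n.
by rewrite EbernZ IH exprS; ring.
Qed.

End BernoulliExpectation.

(** * Burke's theorem and an exponential moment bound *)

(** The queue with arrival probability [p] and service probability [u] has a
    geometric stationary law with ratio [rho], determined by the detailed
    balance between the transitions [v -> v.+1] and [v.+1 -> v]; this is the
    hypothesis [balance]. *)
Section Burke.
Context {R : realType}.
Variables (p u rho z : R).
Hypotheses (p01 : 0 <= p <= 1) (u01 : 0 <= u <= 1) (rho01 : 0 <= rho < 1).
Hypothesis balance : rho * (u * (1 - p)) = p * (1 - u).
Implicit Types (m v M : nat) (f : seq bool -> R).

Let Erow m v f := Ebern u m (fun U => Ebern p m (fun w => f (scan v U w))).

Let ErowS m v f : Erow m.+1 v f =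
  u * p * Erow m v (f \o cons true)
  + u * (1 - p) * Erow m v.-1 (f \o cons (v == 0)%N)
  + (1 - u) * p * Erow m v.+1 (f \o cons true)
  + (1 - u) * (1 - p) * Erow m v (f \o cons false).
Proof.
rewrite /Erow /= !Ebern_linear /= !addnK !addn0 !subn1 !subn0 addn1.
by rewrite mulrDr mulrDr !mulrA !addrA.
Qed.

Let geometric_sum (q : R) M : (1 - q) * (\sum_(v < M) q ^+ v) = 1 - q ^+ M.
Proof.
rewrite -[in RHS](expr1n _ M) subrXX; congr (_ * _).
by apply: eq_bigr => i _; rewrite expr1n mul1r.
Qed.

Let Erow_ge0 m v f : (forall w, 0 <= f w) -> 0 <= Erow m v f.
Proof. by move=> f0; apply: Ebern_ge0 => // U _; apply: Ebern_ge0. Qed.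

(** The four terms are the four values of (bottom increment, weight) in the
    first cell.  Each value of [g1] and of [g0] collects two of them, and
    [balance] makes their weights add up to [u] and [1 - u]; only the truncation
    of the sum leaves a remainder. *)
Let balance_sum (g1 g0 : nat -> R) M :
  \sum_(v < M.+1) rho ^+ v * (u * p * g1 v
    + u * (1 - p) * (if v == 0%N :> nat then g1 0%N else g0 v.-1)
    + (1 - u) * p * g1 v.+1 + (1 - u) * (1 - p) * g0 v) =
  u * (\sum_(v < M.+1) rho ^+ v * g1 v) + (1 - u) * (\sum_(v < M.+1) rho ^+ v * g0 v)
  + u * (1 - p) * rho ^+ M.+1 * (g1 M.+1 - g0 M).
Proof.
have bal : rho * u * p = rho * u - p + p * u by move: balance; lra.
elim: M => [|M IH]; first by rewrite !big_ord1 /= expr1 expr0; ring: bal.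
rewrite big_ord_recr IH /= [in RHS]big_ord_recr /=.
rewrite [X in _ = _ + (1 - u) * X + _]big_ord_recr /=.
set A := \sum_(_ < _) _; set B := \sum_(_ < _) _.
by rewrite !exprS; ring: bal.
Qed.

(** If the left queue length is geometric and the bottom increments are
    i.i.d. Bernoulli([u]), the top increments are again i.i.d. Bernoulli([u]).
    The proof goes cell by cell, since [balance_sum] says that the law of
    (bottom, left) increments of a cell is that of (top, right).  Truncating the
    geometric sum keeps everything finite and costs an inequality. *)
Lemma burke m M f : (forall w, 0 <= f w) ->
  \sum_(v < M) rho ^+ v * Erow m v f <= (1 - rho)^-1 * Ebern u m f.
Proof.
have [r0 r1] := andP rho01; have [u0 u1] := andP u01; have [p0 p1] := andP p01.
have r1' : 0 < 1 - rho by rewrite subr_gt0.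
elim: m M f => [|m IH] M f f0.
  rewrite /Erow /= -mulr_suml mulrC [leRHS]mulrC ler_wpM2l //.
  by rewrite -[leRHS]mulr1 ler_pdivlMl // geometric_sum gerBl exprn_ge0.
case: M => [|M].
  by rewrite big_ord0 mulr_ge0 ?invr_ge0 ?(ltW r1') // Ebern_ge0.
pose g1 v := Erow m v (f \o cons true); pose g0 v := Erow m v (f \o cons false).
have -> : \sum_(v < M.+1) rho ^+ v * Erow m.+1 v f =
  \sum_(v < M.+1) rho ^+ v * (u * p * g1 v
    + u * (1 - p) * (if v == 0%N :> nat then g1 0%N else g0 v.-1)
    + (1 - u) * p * g1 v.+1 + (1 - u) * (1 - p) * g0 v).
  by apply: eq_bigr => -[[|v] ltv] _; rewrite ErowS.
rewrite balance_sum.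
have h1 : \sum_(v < M.+2) rho ^+ v * g1 v <= (1 - rho)^-1 * Ebern u m (f \o cons true).
  by apply: IH => w; exact: f0.
have h0 : \sum_(v < M.+1) rho ^+ v * g0 v <= (1 - rho)^-1 * Ebern u m (f \o cons false).
  by apply: IH => w; exact: f0.
rewrite big_ord_recr /= in h1.
have g10 : 0 <= g1 M.+1 by apply: Erow_ge0 => w; exact: f0.
have g00 : 0 <= g0 M by apply: Erow_ge0 => w; exact: f0.
have rM : 0 <= rho ^+ M.+1 by rewrite exprn_ge0.
move: (ler_wpM2l u0 h1); rewrite -subr_ge0 in u1; move/(ler_wpM2l u1): h0.
rewrite [Ebern u m.+1 f]/= -/(f \o cons true) -/(f \o cons false).
set A := \sum_(_ < _) _; set B := \sum_(_ < _) _.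
have : 0 <= u * p * (rho ^+ M.+1 * g1 M.+1) by rewrite !mulr_ge0.
have : 0 <= u * (1 - p) * (rho ^+ M.+1 * g0 M) by rewrite !mulr_ge0 ?subr_ge0.
set E1 := Ebern _ _ _; set E0 := Ebern _ _ _.
set X := rho ^+ _ * g1 _; set Y := rho ^+ _ * g0 _.
have -> : u * (1 - p) * rho ^+ M.+1 * (g1 M.+1 - g0 M) = u * (1 - p) * X - u * (1 - p) * Y.
  by rewrite /X /Y; ring.
rewrite [_^-1 * (_ + _)]mulrDr ![_^-1 * (_ * _)]mulrCA.
nra.
Qed.

(** The expectation of [z] to the power of the number of ones in row [k],
    started from the increments [U], when each row begins with an empty queue.
    For [U] identically zero this is the moment generating function of a last
    passage value. *)
Fixpoint row_mgf m k U : R :=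
  if k is k'.+1 then Ebern p m (fun w => row_mgf m k' (scan 0 U w))
  else z ^+ count id U.

Hypothesis z1 : 1 <= z.

Let z0 : 0 < z. Proof. exact: lt_le_trans z1. Qed.

Lemma row_mgf_ge0 m k U : 0 <= row_mgf m k U.
Proof.
elim: k U => [|k IH] U /=; first by rewrite exprn_ge0 // ltW.
by apply: Ebern_ge0.
Qed.

Lemma row_mgf_below m k h U h' U' : size U = m -> size U' = m ->
  below h U h' U' -> z ^+ h * row_mgf m k U <= z ^+ h' * row_mgf m k U'.
Proof.
move=> szU szU'; elim: k h U h' U' szU szU' => [|k IH] h U h' U' szU szU' bl /=.
  by rewrite -!exprD ler_weXn2l // below_count // szU.
rewrite -!EbernZ; apply: le_Ebern => // w szw.
apply: IH; rewrite ?size_scan ?szU ?szU' //.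
have hh' : (h <= h')%N by case: (U) (U') bl => [|? ?] [|? ?] /= /andP[].
have := scan_below h U h' U' 0 0 w; rewrite !addn0 szU szU' szw.
by apply.
Qed.

(** Starting a row with an empty queue is compared with starting it with [v]
    customers: this raises heights by at most [v], hence costs a factor [z ^+ v]
    by monotonicity.  Averaging over [v] with weights [(rho / z) ^+ v] turns the
    cost into the geometric law with ratio [rho], to which [burke] applies.  The
    constant is the quotient of the two geometric normalizations. *)
Lemma row_mgf_step m k : Ebern u m (row_mgf m k.+1) <=
  (1 - rho / z) / (1 - rho) * Ebern u m (row_mgf m k).
Proof.
have [r0 r1] := andP rho01.
have q0 : 0 <= rho / z by rewrite divr_ge0 // ltW.
have q1 : rho / z < 1 by rewrite ltr_pdivrMr // mul1r (lt_le_trans r1).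
(* The truncation level M is sent to infinity at the end. *)
have bound M : (1 - (rho / z) ^+ M) * Ebern u m (row_mgf m k.+1) <=
    (1 - rho / z) / (1 - rho) * Ebern u m (row_mgf m k).
  rewrite -geometric_sum -!mulrA; apply: ler_wpM2l; first by rewrite subr_ge0 ltW.
  apply: le_trans (burke m M (row_mgf m k) (row_mgf_ge0 m k)).
  rewrite mulr_suml; apply: ler_sum => v _.
  rewrite expr_div_n -mulrA ler_wpM2l ?exprn_ge0 // ler_pdivrMl ?exprn_gt0 //.
  rewrite /Erow -EbernZ; apply: le_Ebern => // U szU.
  rewrite -EbernZ; apply: le_Ebern => // w szw.
  rewrite -[leLHS]mul1r -(expr0 z); apply: row_mgf_below; rewrite ?size_scan ?szU //.
  have := scan_below 0 U 0 U 0 v w; rewrite !add0n szU szw; apply => //.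
  exact: below_refl.
set X := Ebern u m _ in bound *; set Y := leRHS in bound *.
have cvX : (fun M => (1 - (rho / z) ^+ M) * X) @ \oo --> (1 - 0) * X.
  apply: cvgMr_tmp; apply: cvgB; first exact: cvg_cst.
  by apply: cvg_expr; rewrite ger0_norm.
rewrite subr0 mul1r in cvX.
by apply: (cvgr_to_le cvX); exact: nearW.
Qed.

Lemma row_mgf_le m k : row_mgf m k (nseq m false) <=
  ((1 - rho / z) / (1 - rho)) ^+ k * (1 - u + u * z) ^+ m.
Proof.
have [r0 r1] := andP rho01.
apply: (@le_trans _ _ (Ebern u m (row_mgf m k))).
  rewrite -[leLHS](Ebern_cst u m); apply: le_Ebern => // U szU.
  rewrite -[leLHS]mul1r -[leRHS]mul1r -(expr0 z).
  by apply: row_mgf_below; rewrite ?size_nseq // below_nseq_false.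
elim: k => [|k IH]; first by rewrite /= Ebern_expn expr0 mul1r.
rewrite exprS -mulrA; apply: le_trans (row_mgf_step m k) _.
rewrite ler_wpM2l // divr_ge0 ?subr_ge0 ?(ltW r1) //.
by rewrite ler_pdivrMr // mul1r (le_trans (ltW r1)).
Qed.

End Burke.

(** * From the probability space to finite expectations *)

Section Assign.
Implicit Types (c o : nat * nat -> bool) (s : seq (nat * nat)) (w : seq bool).

Fixpoint assign c s w : nat * nat -> bool :=
  match s, w with
  | v :: s', b :: w' => assign (fun x => if x == v then b else c x) s' w'
  | _, _ => c
  end.

Lemma assign_notin c s w v : v \notin s -> assign c s w v = c v.
Proof.
elim: s c w => [|v' s IH] c [|b w] //=; rewrite inE negb_or => /andP[vv' vs].
by rewrite IH // (negbTE vv').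
Qed.

Lemma assign_in c s w v : uniq s -> size w = size s -> v \in s ->
  assign c s w v = nth false w (index v s).
Proof.
elim: s c w => [|v' s IH] c [|b w] //= /andP[v's us] [sz]; rewrite inE.
have [->|vv'] := eqVneq v v'; first by rewrite assign_notin ?eqxx.
by move=> vs; rewrite IH //= ifN_eqC.
Qed.

Lemma map_assign c s w : uniq s -> size w = size s -> map (assign c s w) s = w.
Proof.
move=> us sz; apply: (@eq_from_nth _ false) => [|i]; rewrite size_map // => lti.
by rewrite (nth_map (0%N, 0%N)) // assign_in ?mem_nth // index_uniq.
Qed.

Lemma assign_cat c s s' w w' : size w = size s ->
  assign c (s ++ s') (w ++ w') = assign (assign c s w) s' w'.
Proof. by elim: s c w => [|v s IH] c [|b w] //= [/IH ->]. Qed.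

(** Stated for boolean functions of the whole weight field, so that the same
    function can be evaluated on random and on explicitly assigned weights. *)
Definition depends_on s (Q : (nat * nat -> bool) -> bool) :=
  forall o o', {in s, o =1 o'} -> Q o = Q o'.

End Assign.

Section FiniteMarginals.
Context {R : realType} {d : measure_display} {T : measurableType d}.
Variables (P : probability T R) (p : R) (om : nat * nat -> {RV P >-> bool}).
Hypothesis indep : mutually_independent P om.
Hypothesis law : forall v, P [set x | om v x = true] = p%:E.
Implicit Types (c : nat * nat -> bool) (s : seq (nat * nat)).
Implicit Types Q : (nat * nat -> bool) -> bool.

Let bern b : R := if b then p else 1 - p.

Let measurable_om v b : measurable (om v @^-1` [set b]).
Proof. exact: measurable_funPTI. Qed.

Let prob_om v b : P (om v @^-1` [set b]) = (bern b)%:E.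
Proof.
case: b; first exact: law.
have -> : om v @^-1` [set false] = ~` (om v @^-1` [set true]).
  by apply/seteqP; split => x /=; case: (om v x).
by rewrite probability_setC // (law v).
Qed.

Let cylinder s c := \bigcap_(v in [set` s]) om v @^-1` [set c v].

Let prob_cylinder s c : uniq s ->
  measurable (cylinder s c) /\ P (cylinder s c) = (\prod_(v <- s) bern (c v))%:E.
Proof.
move=> us; split.
  by apply: fin_bigcap_measurable => // v _; exact: measurable_om.
rewrite (indep s (fun v => [set c v]) us) //.
by rewrite -prodEFin; apply: eq_bigr => v _; exact: prob_om.
Qed.

Let event Q : set T := [set x | Q (fun v => om v x)].

(** Generalized for the induction: the coordinates in [s'] are already fixed
    to the values of [c], and those in [s] are fixed one at a time by splitting
    according to the value of the next weight.  Once all coordinates are fixed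
    the event is either empty or a full cylinder, whose probability is given by
    independence. *)
Let prob_event_cylinder s s' c Q : uniq (s' ++ s) -> depends_on (s' ++ s) Q ->
  measurable (event Q `&` cylinder s' c) /\
  P (event Q `&` cylinder s' c) =
  (\prod_(v <- s') bern (c v) *
   Ebern p (size s) (fun w => (Q (assign c s w))%:R))%:E.
Proof.
elim: s s' c => [|v s IH] s' c.
  rewrite cats0 => us' dep /=.
  have [mC PC] := prob_cylinder s' c us'.
  have agree x : cylinder s' c x -> Q (fun v => om v x) = Q c.
    by move=> cx; apply: dep => v vs'; exact: cx.
  case Qc : (Q c).
    rewrite (_ : _ `&` _ = cylinder s' c) ?mulr1 //.
    apply/seteqP; split=> x; first by case.
    by move=> cx; split=> //; rewrite /event /= agree.
  rewrite (_ : _ `&` _ = set0) ?mulr0 ?measure0; first by split.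
  by apply/seteqP; split=> x // [] + /agree; rewrite /event /= => ->; rewrite Qc.
move=> us dep.
have us1 : uniq ((v :: s') ++ s) by have := us; rewrite -(cat1s v s) uniq_catCA.
have dep1 : depends_on ((v :: s') ++ s) Q.
  move=> o o' oo'; apply: dep => x; rewrite mem_cat inE => xs; apply: oo'.
  by move: xs => /or3P[] xs; rewrite mem_cat inE xs ?orbT.
pose cb b x := if x == v then b else c x.
have vs' : v \notin s' by move: us1 => /= /andP[]; rewrite mem_cat negb_or => /andP[].
have cylE b : cylinder (v :: s') (cb b) = cylinder s' c `&` om v @^-1` [set b].
  apply/seteqP; split=> x.
    move=> cx; split=> [u us'|].
      have := cx u; rewrite /= inE us' orbT /cb => /(_ isT).
      by case: eqVneq => // uv; rewrite -uv us' in vs'.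
    by have := cx v; rewrite /= inE eqxx /cb eqxx => /(_ isT).
  move=> [cx ox] u /=; rewrite inE /cb; case: eqVneq => [-> //|_] /= us'; exact: cx.
have [m1 P1] := IH (v :: s') (cb true) us1 dep1.
have [m0 P0] := IH (v :: s') (cb false) us1 dep1.
have splitE : event Q `&` cylinder s' c =
    (event Q `&` cylinder (v :: s') (cb true)) `|`
    (event Q `&` cylinder (v :: s') (cb false)).
  rewrite !cylE; apply/seteqP; split=> x.
    by move=> [Qx cx]; case ox : (om v x); [left|right].
  by case=> -[Qx [cx _]].
rewrite splitE; split; first exact: measurableU.
have -> : P ((event Q `&` cylinder (v :: s') (cb true)) `|`
             (event Q `&` cylinder (v :: s') (cb false))) =
          (P (event Q `&` cylinder (v :: s') (cb true)) +
           P (event Q `&` cylinder (v :: s') (cb false)))%E.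
  apply: measureU => //; rewrite !cylE; apply/seteqP; split=> x //.
  by move=> [[_ [_ /= ->]]] [_ [_]].
rewrite P1 P0 -EFinD !big_cons /cb eqxx /=; congr (_%:E).
have prodE b : \prod_(u <- s') bern (if u == v then b else c u) =
    \prod_(u <- s') bern (c u).
  by apply: eq_big_seq => u us'; case: eqVneq => // uv; rewrite -uv us' in vs'.
by rewrite !prodE /bern /=; ring.
Qed.

Lemma prob_depends s Q : uniq s -> depends_on s Q ->
  measurable [set x | Q (fun v => om v x)] /\
  P [set x | Q (fun v => om v x)] =
  (Ebern p (size s) (fun w => (Q (assign (fun=> false) s w))%:R))%:E.
Proof.
move=> us dep; have := @prob_event_cylinder s [::] (fun=> false) Q us dep.
rewrite big_nil mul1r (_ : cylinder _ _ = setT) ?setIT //.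
by apply/seteqP; split=> x // _ v; rewrite /= in_nil.
Qed.

Lemma prob_indep s s' Q Q' : uniq (s ++ s') -> depends_on s Q ->
  depends_on s' Q' ->
  P [set x | Q (fun v => om v x) && Q' (fun v => om v x)] =
  (P [set x | Q (fun v => om v x)] * P [set x | Q' (fun v => om v x)])%E.
Proof.
move=> us depQ depQ'; have := us; rewrite cat_uniq => /and3P[u1 /hasPn dis u2].
have [_ ->] := prob_depends s Q u1 depQ.
have [_ ->] := prob_depends s' Q' u2 depQ'.
have [|_ ->] := prob_depends (s ++ s') (fun o => Q o && Q' o) us.
  move=> o o' oo'; congr (_ && _); [apply: depQ|apply: depQ'] => v vs;
  by apply: oo'; rewrite mem_cat vs ?orbT.
rewrite size_cat Ebern_cat -EFinM; congr (_%:E).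
set E' := (X in _ = _ * X).
rewrite mulrC -EbernZ; apply: eq_Ebern => w szw.
rewrite mulrC -EbernZ; apply: eq_Ebern => w' szw'.
rewrite -natrM mulnb assign_cat //; congr ((_ && _)%:R).
  apply: depQ => v vs; rewrite assign_notin //.
  by apply/negP => /dis; rewrite vs.
by apply: depQ' => v vs; rewrite !assign_in.
Qed.

Lemma prob_shift s Q (tau : nat * nat -> nat * nat) : injective tau ->
  uniq s -> depends_on s Q ->
  P [set x | Q (fun v => om (tau v) x)] = P [set x | Q (fun v => om v x)].
Proof.
move=> inj us dep; have [_ ->] := prob_depends s Q us dep.
have usm : uniq (map tau s) by rewrite map_inj_uniq.
have [|_ ->] := prob_depends (map tau s) (fun o => Q (o \o tau)) usm.
  by move=> o o' oo'; apply: dep => v vs; apply: oo'; exact: map_f.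
rewrite size_map; congr (_%:E); apply: eq_Ebern => w szw; congr (_%:R).
congr (nat_of_bool _); apply: dep => v vs /=.
by rewrite !assign_in ?size_map ?map_f // index_map.
Qed.

End FiniteMarginals.

(** * Tails of last passage values *)

Section Grid.
Implicit Types (m n j k : nat).

Definition row_points m j : seq (nat * nat) := mkseq (fun i => (i.+1, j)) m.

Fixpoint rows m j k : seq (nat * nat) :=
  if k is k'.+1 then row_points m j ++ rows m j.+1 k' else [::].

Lemma weight_rowE o m j : weight_row o m j = map o (row_points m j).
Proof. by rewrite /weight_row /row_points /mkseq -map_comp. Qed.

Lemma mem_row_points m j i j' :
  ((i, j') \in row_points m j) = (0 < i <= m)%N && (j' == j).
Proof.
apply/mapP/idP => [[l]|].
  by rewrite mem_iota => /andP[_ lm] [-> ->]; rewrite eqxx andbT.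
case: i => // i /andP[im /eqP ->]; exists i => //.
by rewrite mem_iota add0n.
Qed.

Lemma mem_rows m j k i j' :
  ((i, j') \in rows m j k) = (0 < i <= m)%N && (j <= j' < j + k)%N.
Proof.
elim: k j => [|k IH] j /=; first by rewrite in_nil; lia.
by rewrite mem_cat mem_row_points IH; lia.
Qed.

Lemma uniq_row_points m j : uniq (row_points m j).
Proof. by rewrite map_inj_uniq ?iota_uniq // => a b []. Qed.

Lemma uniq_rows m j k : uniq (rows m j k).
Proof.
elim: k j => [//|k IH] j /=; rewrite cat_uniq uniq_row_points IH andbT /=.
apply/hasPn => -[i j'].
by rewrite mem_rows mem_row_points => /andP[_ lt]; apply/negP; lia.
Qed.

(** The rows are integrated out from the bottom one up: the weights of one
    row enter the remaining expectation only through the increments that they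
    produce. *)
Lemma Ebern_rows_mgf {R : realType} (p z : R) m c j k :
  Ebern p (size (rows m j k))
    (fun w => z ^+ count id (increments (assign c (rows m j k) w) m (j + k))) =
  row_mgf p z m k (increments c m j).
Proof.
elim: k j c => [|k IH] j c /=; first by rewrite addn0.
rewrite size_cat Ebern_cat size_mkseq; apply: eq_Ebern => w szw.
have szw' : size w = size (row_points m j) by rewrite size_mkseq.
rewrite (@eq_Ebern _ _ _ _ (fun w' => z ^+ count id (increments
   (assign (assign c (row_points m j) w) (rows m j.+1 k) w') m (j.+1 + k)))).
  rewrite IH /= weight_rowE map_assign ?uniq_row_points //.
  congr (row_mgf _ _ _ _ (scan _ _ _)); apply: eq_increments => i j' ltj.
  by rewrite assign_notin // mem_row_points; lia.
by move=> w' _; rewrite assign_cat // addSnnS.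
Qed.

End Grid.

Section Tails.
Context {R : realType} {d : measure_display} {T : measurableType d}.
Variables (P : probability T R) (p : R) (om : nat * nat -> {RV P >-> bool}).
Hypothesis p_gt0 : 0 < p.
Hypothesis p_lt1 : p < 1.
Hypothesis indep : mutually_independent P om.
Hypothesis law : forall v, P [set x | om v x = true] = p%:E.
Implicit Types (m n : nat) (y z u : R).

Let grid m n := rows m 0 n.+1.

Let exceed m n y : (nat * nat -> bool) -> bool := fun o => y <= (lpp o m n)%:R.

Let depends_exceed m n y : depends_on (grid m n) (exceed m n y).
Proof.
move=> o o' oo'; congr (_ <= _%:R); apply: eq_lpp => i j im jn.
by apply: oo'; rewrite mem_rows im /= add0n ltnS.
Qed.

Definition tail m n y : R :=
  fine (P [set x | y <= (lpp (fun v => om v x) m n)%:R]).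

Lemma tailE m n y :
  P [set x | y <= (lpp (fun v => om v x) m n)%:R] = (tail m n y)%:E.
Proof.
have [_] := prob_depends P p om indep law _ _ (uniq_rows m 0 n.+1) (depends_exceed m n y).
by rewrite /exceed /tail => ->.
Qed.

Let measurable_tail m n y :
  measurable [set x | y <= (lpp (fun v => om v x) m n)%:R].
Proof.
by have [] := prob_depends P p om indep law _ _ (uniq_rows m 0 n.+1) (depends_exceed m n y).
Qed.

Lemma tail_le1 m n y : tail m n y <= 1.
Proof. by rewrite -lee_fin -tailE probability_le1. Qed.

Lemma le_tail m n y m' n' y' : (m <= m')%N -> (n <= n')%N -> y' <= y ->
  tail m n y <= tail m' n' y'.
Proof.
move=> mm' nn' yy'; rewrite -lee_fin -!tailE.
apply: le_measure; rewrite ?inE; [exact: measurable_tail..|].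
move=> x /= /(le_trans yy') /le_trans; apply.
by rewrite ler_nat leq_lpp.
Qed.

(** Superadditivity, together with independence of the weights in the two
    groups of columns and invariance of their law under translation. *)
Lemma tail_supermul m n y m' n' y' :
  tail m n y * tail m' n' y' <= tail (m + m') (n + n') (y + y').
Proof.
pose tau (v : nat * nat) := (m + v.1, n + v.2)%N.
have inj : injective tau by move=> [a b] [a' b'] [/addnI -> /addnI ->].
have depM : depends_on (map tau (grid m' n')) (fun o => exceed m' n' y' (o \o tau)).
  by move=> o o' oo'; apply: depends_exceed => v vs; apply: oo'; exact: map_f.
have us : uniq (grid m n ++ map tau (grid m' n')).
  rewrite cat_uniq uniq_rows map_inj_uniq // uniq_rows andbT /=.
  apply/hasPn => _ /mapP[[i j]] + ->; rewrite !mem_rows /=.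
  by move=> ij; apply/negP; clear - ij; lia.
rewrite -lee_fin EFinM -!tailE.
rewrite -(prob_shift P p om indep law _ _ tau inj (uniq_rows m' 0 n'.+1)
  (depends_exceed m' n' y')).
have <- := prob_indep P p om indep law _ _ _ _ us (depends_exceed m n y) depM.
apply: le_measure; rewrite ?inE; [|exact: measurable_tail|].
  have [] // := prob_depends P p om indep law _
    (fun o => exceed m n y o && exceed m' n' y' (o \o tau)) us.
  move=> o o' oo'; congr (_ && _); [apply: depends_exceed|apply: depM] => v vs;
  by apply: oo'; rewrite mem_cat vs ?orbT.
move=> x /= /andP[h h']; apply: le_trans (lerD h h') _.
by rewrite -natrD ler_nat lpp_superadd.
Qed.

(** Superadditivity again: the bottom row alone reaches [m] when all its
    weights equal one. *)
Lemma tail_ge m n y : y <= m%:R -> p ^+ m <= tail m n y.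
Proof.
move=> ym; apply: le_trans (le_tail m 0 m%:R m n y _ _ ym) => //.
elim: m {ym} => [|m IH].
  rewrite expr0 -lee_fin -tailE (_ : [set _ | _] = setT) ?probability_setT //.
  by apply/seteqP; split=> // x _; rewrite /= ler_nat.
have t10 : tail 1 0 1 = p.
  apply/EFin_inj; rewrite -tailE -(law (1%N, 0%N)); congr (P _).
  by apply/seteqP; split=> x /=; rewrite ler1n add0n lt0b.
have := tail_supermul m 0 m%:R 1 0 1; rewrite addn1 natr1 t10; apply: le_trans.
by rewrite exprSr ler_wpM2r // ltW.
Qed.

Lemma tail_gt0 m n y : y <= m%:R -> 0 < tail m n y.
Proof. by move=> ym; apply: lt_le_trans (tail_ge m n y ym); rewrite exprn_gt0. Qed.

(** Markov's inequality for [expR lam] to the power of the last passage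
    value.  The exponent [n.+1] counts the rows [0], ..., [n]. *)
Lemma tail_chernoff m n y u (rho lam : R) : p < u < 1 -> 0 <= lam ->
  rho = p * (1 - u) / (u * (1 - p)) ->
  tail m n y * expR (lam * y) <=
  ((1 - rho / expR lam) / (1 - rho)) ^+ n.+1 * (1 - u + u * expR lam) ^+ m.
Proof.
move=> /andP[pu u1] lam0 rhoE.
have u0 : 0 < u by exact: lt_trans pu.
have rho0 : 0 <= rho by rewrite rhoE divr_ge0 // mulr_ge0 ?subr_ge0 // ltW.
have den0 : 0 < u * (1 - p) by rewrite mulr_gt0 // subr_gt0.
have rho1 : rho < 1 by rewrite rhoE ltr_pdivrMr // mul1r; lra.
have z1 : 1 <= expR lam by rewrite -expR0 ler_expR.
have bal : rho * (u * (1 - p)) = p * (1 - u) by rewrite rhoE divfK // gt_eqF.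
have p01 : 0 <= p <= 1 by rewrite !ltW.
have u01 : 0 <= u <= 1 by rewrite !ltW.
have rho01 : 0 <= rho < 1 by rewrite rho0.
apply: le_trans (row_mgf_le _ _ _ _ p01 u01 rho01 bal z1 m n.+1).
rewrite -(Ebern_rows_mgf p (expR lam) m (fun=> false) 0 n.+1).
have [_] := prob_depends P p om indep law _ _ (uniq_rows m 0 n.+1) (depends_exceed m n y).
rewrite -[P _]/(P [set x | y <= (lpp (fun v => om v x) m n)%:R]) tailE => -[->].
rewrite mulrC -EbernZ; apply: le_Ebern => [|w szw]; first exact: p01.
rewrite add0n count_increments /exceed; case yle: (y <= _); last first.
  by rewrite mulr0 exprn_ge0 // expR_ge0.
by rewrite mulr1 -expRM_natl ler_expR mulrC ler_wpM2r.
Qed.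

End Tails.

(** * The rate function on an open cone *)

Section Fekete.
Context {R : realType}.

(** Fekete's lemma for sequences whose subadditivity holds only beyond
    [N0]. *)
Lemma fekete (a : nat -> R) (C : R) (N0 : nat) :
  (forall n, (N0 <= n)%N -> 0 <= a n <= C * n%:R) ->
  (forall m n, (N0 <= m)%N -> (N0 <= n)%N -> a (m + n)%N <= a m + a n) ->
  cvg ((fun n => a n / n%:R) @ \oo).
Proof.
move=> bnd sub; pose S := [set a n / n%:R | n in [set n | (N0.+1 <= n)%N]].
have lbS : lbound S 0.
  by move=> _ [n ltn <-]; have /andP[? _] := bnd n (ltnW ltn); rewrite divr_ge0.
have infS : has_inf S by split; [exists (a N0.+1 / N0.+1%:R); exists N0.+1 => /= | exists 0].
apply/cvg_ex; exists (inf S); apply/cvgrPdist_le => eps eps0.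
have [_ [M /= ltM <-] aM] := inf_adherent (divr_gt0 eps0 (ltr0n R 2)) infS.
have M0 : 0 < M%:R :> R by rewrite ltr0n (leq_trans _ ltM).
have /andP[aM0 aMC] := bnd M (ltnW ltM).
have C0 : 0 <= C by rewrite -(pmulr_lge0 _ M0) (le_trans aM0).
have suba q r : (N0 <= r)%N -> a (q * M + r)%N <= q%:R * a M + a r.
  move=> ler; elim: q => [|q IH]; first by rewrite mul0r add0r.
  rewrite mulSn -addnA; apply: le_trans (sub _ _ (ltnW ltM) _) _.
    by rewrite (leq_trans ler) // leq_addl.
  by rewrite -natr1; move: IH; lra.
near=> n.
have leMn : (2 * M <= n)%N by near: n; exact: nbhs_infty_ge.
have n0 : 0 < n%:R :> R by rewrite ltr0n; lia.
have bigC : 2 * C * (2 * M%:R) / eps <= n%:R by near: n; exact: nbhs_infty_ger.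
have lowb : inf S <= a n / n%:R.
  by apply: ge_inf; [exists 0 | exists n => //=; lia].
rewrite distrC ger0_norm ?subr_ge0 // lerBlDr.
(* The remainder lies between M and 2 * M instead of below M, which keeps
   every use of subadditivity beyond N0. *)
pose q := (n %/ M).-1; pose r := (n %% M + M)%N.
have nE : n = (q * M + r)%N.
  have dM : (0 < n %/ M)%N by rewrite divn_gt0; lia.
  by rewrite /q /r addnCA -mulSnr prednK // addnC -divn_eq.
have rM : (r <= 2 * M)%N by rewrite /r; have := ltn_pmod n (leq_trans (ltn0Sn N0) ltM); lia.
have rN : (N0 <= r)%N by rewrite /r; lia.
have /andP[_ arC] := bnd r rN.
have aML : a M <= (inf S + eps / 2) * M%:R by rewrite -ler_pdivrMr // ltW.
rewrite ler_pdivrMr // {1}nE; apply: le_trans (suba q r rN) _.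
have rC : C * r%:R <= C * (2 * M%:R).
  by rewrite ler_wpM2l // -natrM ler_nat.
have bigC' : C * (2 * M%:R) <= eps / 2 * n%:R.
  by move: bigC; rewrite ler_pdivrMr //; lra.
have infS0 : 0 <= inf S by apply: lb_le_inf => //; case: infS.
have qM : q%:R * ((inf S + eps / 2) * M%:R) <= (inf S + eps / 2) * n%:R.
  rewrite mulrCA ler_wpM2l ?addr_ge0 ?divr_ge0 ?(ltW eps0) //.
  by rewrite -natrM ler_nat [leqRHS]nE leq_addr.
have := ler_wpM2l (ler0n R q) aML.
by move: arC rC bigC' qM; lra.
Unshelve. all: by end_near. Qed.

End Fekete.

Section Rate.
Context {R : realType}.
Variables (tl : nat -> nat -> R -> R) (C : R).
Hypothesis tl_gt0 : forall m n y, y <= m%:R -> 0 < tl m n y.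
Hypothesis tl_le1 : forall m n y, tl m n y <= 1.
Hypothesis le_tl : forall m n y m' n' y',
  (m <= m')%N -> (n <= n')%N -> y' <= y -> tl m n y <= tl m' n' y'.
Hypothesis tl_supermul : forall m n y m' n' y',
  tl m n y * tl m' n' y' <= tl (m + m') (n + n') (y + y').
Hypothesis tl_lower : forall m n y, y <= m%:R -> - ln (tl m n y) <= C * m%:R.
Hypothesis C_ge0 : 0 <= C.
Implicit Types (s t r x y z c : R) (N : nat).

(** Real arguments, rounded inside, let the scaling [N%:R * s] be added and
    multiplied freely.  The threshold [z] is never rounded. *)
Definition cost x y z := - ln (tl (Num.truncn x) (Num.truncn y) z).

Definition rate s t r :=
  lim ((fun N => cost (N%:R * s) (N%:R * t) (N%:R * r) / N%:R) @ \oo).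

Let ok x z := z <= (Num.truncn x)%:R.

Let truncn_superadd x x' : 0 <= x -> 0 <= x' ->
  (Num.truncn x + Num.truncn x' <= Num.truncn (x + x'))%N.
Proof.
move=> x0 x'0; rewrite truncn_ge_nat ?addr_ge0 // natrD lerD //.
  by rewrite truncn_le.
by rewrite truncn_le.
Qed.

Let cost_ge0 x y z : 0 <= cost x y z.
Proof. by rewrite oppr_ge0 ln_le0. Qed.

Let cost_le x y z : 0 <= x -> ok x z -> cost x y z <= C * x.
Proof.
by move=> x0 /tl_lower h; apply: le_trans (h _) _; rewrite ler_wpM2l // truncn_le.
Qed.

(** The condition [ok x z] is needed because [ln] is constant on nonpositive
    arguments: it would not reflect the order between a vanishing tail and a
    positive one. *)
Let le_cost x y z x' y' z' : ok x z -> x <= x' -> y <= y' -> z' <= z ->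
  cost x' y' z' <= cost x y z.
Proof.
move=> okx xx' yy' zz'; have mx := le_truncn xx'.
rewrite lerN2 ler_ln ?posrE ?tl_gt0 //; first by apply: le_tl => //; exact: le_truncn.
by apply: le_trans zz' (le_trans okx _); rewrite ler_nat.
Qed.

Let cost_subadd x y z x' y' z' : 0 <= x -> 0 <= y -> 0 <= x' -> 0 <= y' ->
  ok x z -> ok x' z' ->
  cost (x + x') (y + y') (z + z') <= cost x y z + cost x' y' z'.
Proof.
move=> x0 y0 x'0 y'0 okx okx'; rewrite /cost -opprD lerN2.
have tx := truncn_superadd x x' x0 x'0.
rewrite -lnM ?posrE ?tl_gt0 // ler_ln ?posrE ?mulr_gt0 ?tl_gt0 //.
  by apply: le_trans (tl_supermul _ _ _ _ _ _) _; apply: le_tl => //; exact: truncn_superadd.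
by apply: le_trans (lerD okx okx') _; rewrite -natrD ler_nat.
Qed.

(** Negative [r] are included.  There the events are certain, and the face
    [r = 0] of the domain of interest becomes interior. *)
Definition cone s t r := [/\ 0 <= s, 0 <= t & r < s].

Let ok_near s t r : cone s t r ->
  exists N0, forall N, (N0 <= N)%N -> ok (N%:R * s) (N%:R * r).
Proof.
move=> [s0 t0 rs]; exists (Num.truncn (s - r)^-1).+1 => N leN; rewrite /ok.
have sr0 : 0 < s - r by rewrite subr_gt0.
have hN : (s - r)^-1 < N%:R.
  by apply: lt_le_trans (truncnS_gt _) _; rewrite ler_nat.
have h1 : 1 <= N%:R * (s - r) by rewrite -ler_pdivrMr // div1r ltW.
have := truncnS_gt (N%:R * s); rewrite -natr1; move: h1; lra.
Qed.

Lemma rate_cvg s t r : cone s t r ->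
  (fun N => cost (N%:R * s) (N%:R * t) (N%:R * r) / N%:R) @ \oo --> rate s t r.
Proof.
move=> cn; have [s0 t0 _] := cn; have [N0 okN] := ok_near _ _ _ cn.
apply: (fekete (fun N => cost (N%:R * s) (N%:R * t) (N%:R * r)) (C * s) N0).
  by move=> N leN; rewrite cost_ge0 -mulrA [s * _]mulrC cost_le ?mulr_ge0 // okN.
move=> m n lem len; rewrite natrD !mulrDl.
by apply: cost_subadd; rewrite ?mulr_ge0 ?okN.
Qed.

Lemma threshold_le_truncn_near s t r : cone s t r ->
  \forall N \near \oo, N%:R * r <= (Num.truncn (N%:R * s))%:R.
Proof.
by move=> /ok_near[N0 okN]; near=> N; apply: okN; near: N; exact: nbhs_infty_ge.
Unshelve. all: by end_near. Qed.

Lemma rate_ge0 s t r : cone s t r -> 0 <= rate s t r.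
Proof.
move=> cn; apply: cvgr_to_ge (rate_cvg _ _ _ cn) _.
by apply: nearW => N; rewrite divr_ge0.
Qed.

Lemma rate_le s t r : cone s t r -> rate s t r <= C * s.
Proof.
move=> cn; have [s0 t0 _] := cn; have := threshold_le_truncn_near _ _ _ cn => okN.
apply: cvgr_to_le (rate_cvg _ _ _ cn) _; near=> N.
have N0 : 0 < N%:R :> R by rewrite ltr0n; near: N; exact: nbhs_infty_gt.
rewrite ler_pdivrMr // -mulrA [s * _]mulrC cost_le ?mulr_ge0 //.
by near: N.
Unshelve. all: by end_near. Qed.

Lemma rate_mono s t r s' t' r' : cone s t r -> s <= s' -> t <= t' -> r' <= r ->
  rate s' t' r' <= rate s t r.
Proof.
move=> cn ss' tt' rr'; have [s0 t0 rs] := cn.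
have cn' : cone s' t' r' by split; lra.
have okN := threshold_le_truncn_near _ _ _ cn.
rewrite -subr_ge0; apply: cvgr_to_ge (cvgB (rate_cvg _ _ _ cn) (rate_cvg _ _ _ cn')) _.
near=> N; rewrite /= -mulrBl divr_ge0 // subr_ge0.
by apply: le_cost; rewrite ?ler_wpM2l // /ok; near: N.
Unshelve. all: by end_near. Qed.

Lemma rate_subadd s t r s' t' r' : cone s t r -> cone s' t' r' ->
  rate (s + s') (t + t') (r + r') <= rate s t r + rate s' t' r'.
Proof.
move=> cn cn'; have [s0 t0 rs] := cn; have [s'0 t'0 rs'] := cn'.
have cn2 : cone (s + s') (t + t') (r + r') by split; lra.
have okN := threshold_le_truncn_near _ _ _ cn; have okN' := threshold_le_truncn_near _ _ _ cn'.
rewrite -subr_ge0; apply: cvgr_to_ge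
  (cvgB (cvgD (rate_cvg _ _ _ cn) (rate_cvg _ _ _ cn')) (rate_cvg _ _ _ cn2)) _.
near=> N; rewrite /= !fctE -mulrDl -mulrBl divr_ge0 // subr_ge0 !mulrDr.
by apply: cost_subadd; rewrite ?mulr_ge0 // /ok; near: N.
Unshelve. all: by end_near. Qed.

Lemma cone_scale c s t r : 0 < c -> cone s t r -> cone (c * s) (c * t) (c * r).
Proof. by move=> c0 [s0 t0 rs]; split; rewrite ?mulr_ge0 ?ltr_pM2l // ltW. Qed.

Let rate_natmul k s t r : cone s t r ->
  rate (k.+1%:R * s) (k.+1%:R * t) (k.+1%:R * r) = k.+1%:R * rate s t r.
Proof.
move=> cn; have k0 : (k.+1%:R : R) != 0 by rewrite pnatr_eq0.
have cnk := cone_scale k.+1%:R _ _ _ (ltr0Sn _ _) cn.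
apply: cvg_unique (rate_cvg _ _ _ cnk) _ => //.
have sub : (fun N => N * k.+1)%N @ \oo --> \oo.
  apply/cvgnyPge => A; near=> N; apply: leq_trans (leq_pmulr _ _) => //.
  by near: N; exact: nbhs_infty_ge.
pose g N := cost (N%:R * s) (N%:R * t) (N%:R * r) / N%:R.
have : (fun N => k.+1%:R * (g \o (fun N => N * k.+1)%N) N) @ \oo --> k.+1%:R * rate s t r.
  by apply: cvgMl_tmp; apply: cvg_comp sub _; exact: rate_cvg.
apply: cvg_trans; apply: near_eq_cvg; near=> N; rewrite /= /g.
rewrite natrM -!mulrA invfM; set X := cost _ _ _.
by rewrite mulrCA [N%:R^-1 * _]mulrC mulVKf.
Unshelve. all: by end_near. Qed.

(** For integer factors homogeneity comes from passing to a subsequence.  For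
    real [c], multiplying by a large integer [k.+1] and splitting [k.+1%:R * c]
    into an integer and a part of size at most 2 gives the inequality up to an
    error that does not grow with [k]. *)
Let rate_scale_le c s t r : 0 < c -> cone s t r ->
  rate (c * s) (c * t) (c * r) <= c * rate s t r.
Proof.
move=> c0 cn; have [s0 t0 rs] := cn; set f := rate s t r.
have f0 : 0 <= f by exact: rate_ge0.
have key k : k.+1%:R * (rate (c * s) (c * t) (c * r) - c * f) <= 2 * (C * s).
  rewrite mulrBr -rate_natmul; last exact: cone_scale.
  rewrite ![k.+1%:R * (c * _)]mulrA; set x := k.+1%:R * c.
  have x0 : 0 < x by rewrite mulr_gt0 // ltr0n.
  have /andP[lex gtx] := truncn_itv (ltW x0).
  have small w : 0 < w -> w <= 2 -> rate (w * s) (w * t) (w * r) <= 2 * (C * s).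
    move=> w0 w2; apply: le_trans (rate_le _ _ _ (cone_scale _ _ _ _ w0 cn)) _.
    by rewrite mulrCA ler_wpM2r ?mulr_ge0.
  have xf0 : 0 <= x * f by rewrite mulr_ge0 // ltW.
  case ex : (Num.truncn x) lex gtx => [|[|j]] lex gtx.
  - by have := small x x0; move: xf0 gtx lex; lra.
  - by have := small x x0; move: xf0 gtx lex; lra.
  pose w := x - j.+1%:R.
  have w1 : 1 <= w by move: lex; rewrite -natr1 /w; lra.
  have w2 : w <= 2 by move: gtx; rewrite -2!natr1 /w; lra.
  have xE : x = j.+1%:R + w by rewrite /w addrC subrK.
  have w0 : 0 < w by exact: lt_le_trans w1.
  have := rate_subadd _ _ _ _ _ _ (cone_scale _ _ _ _ (ltr0Sn R j) cn)
    (cone_scale _ _ _ _ w0 cn).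
  rewrite -!mulrDl -xE rate_natmul // -/f => h.
  have := small w w0 w2.
  have : j.+1%:R * f <= x * f by rewrite ler_wpM2r // xE lerDl ltW.
  by move: h; lra.
rewrite leNgt; apply/negP => lt; set D := (_ - _) in key.
have D0 : 0 < D by rewrite subr_gt0.
have := key (Num.truncn (2 * (C * s) / D)); rewrite -ler_pdivlMr //.
by rewrite leNgt truncnS_gt.
Qed.

Lemma rate_scale c s t r : 0 < c -> cone s t r ->
  rate (c * s) (c * t) (c * r) = c * rate s t r.
Proof.
move=> c0 cn; apply/eqP; rewrite eq_le rate_scale_le //=.
have ci : 0 < c^-1 by rewrite invr_gt0.
have := rate_scale_le _ _ _ _ ci (cone_scale _ _ _ _ c0 cn).
by rewrite !mulKf ?gt_eqF // ler_pdivlMl.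
Qed.

End Rate.

(** * Continuous extension to the closed cone *)

(** The function [f] is positively homogeneous and subadditive, hence convex,
    with linear growth in [s].  What makes a continuous extension possible is
    that the cone is polyhedral: if [x] is in the closed cone and [y] is a nearby
    point of it, then [y - (1 - q) * x] is still in the closed cone for a small
    positive [q], as each linear inequality that is strict at [x] has some room
    and each one that is an equality at [x] holds at [y]. *)
Section Extension.
Context {R : realType}.
Variables (f : R -> R -> R -> R) (C : R).
Hypothesis C_gt0 : 0 < C.
Hypothesis f_ge0 : forall s t r, cone s t r -> 0 <= f s t r.
Hypothesis f_le : forall s t r, cone s t r -> f s t r <= C * s.
Hypothesis f_mono : forall s t r s' t' r', cone s t r ->
  s <= s' -> t <= t' -> r' <= r -> f s' t' r' <= f s t r.
Hypothesis f_subadd : forall s t r s' t' r', cone s t r -> cone s' t' r' ->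
  f (s + s') (t + t') (r + r') <= f s t r + f s' t' r'.
Hypothesis f_scale : forall c s t r, 0 < c -> cone s t r ->
  f (c * s) (c * t) (c * r) = c * f s t r.
Implicit Types (s t r c e : R).

Definition closed_cone s t r := [/\ 0 <= s, 0 <= t & r <= s].

(** The direction [(1, 1, 0)] leads from every point of the closed cone into
    the open one, and [f] decreases along it; so the supremum is the limit as
    [e] tends to 0. *)
Definition fbar s t r := sup [set f (s + e) (t + e) r | e in [set e | 0 < e]].

Let cone_shift s t r e : closed_cone s t r -> 0 < e -> cone (s + e) (t + e) r.
Proof. by move=> [s0 t0 rs] e0; split; lra. Qed.

Let f_shift_le s t r e : closed_cone s t r -> 0 < e -> f (s + e) (t + e) r <= C * s.
Proof.
move=> cn e0; apply/ler_addgt0Pl => d d0.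
pose m := Num.min e (d / C).
have m0 : 0 < m by rewrite lt_min e0 divr_gt0.
have me : m <= e by rewrite ge_min lexx.
have md : C * m <= d by rewrite mulrC -ler_pdivlMr // ge_min lexx orbT.
apply: le_trans (f_mono _ _ _ _ _ _ (cone_shift _ _ _ _ cn m0) _ _ (lexx r)) _;
  rewrite ?lerD2l //.
apply: le_trans (f_le _ _ _ (cone_shift _ _ _ _ cn m0)) _.
by rewrite mulrDr addrC lerD2r.
Qed.

Let fbar_has_sup s t r : closed_cone s t r ->
  has_sup [set f (s + e) (t + e) r | e in [set e | 0 < e]].
Proof.
move=> cn; split; first by exists (f (s + 1) (t + 1) r); exists 1 => /=.
by exists (C * s) => _ [e /= e0 <-]; exact: f_shift_le.
Qed.

Lemma fbar_ge s t r e : closed_cone s t r -> 0 < e -> f (s + e) (t + e) r <= fbar s t r.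
Proof.
by move=> cn e0; apply: ub_le_sup; [case: (fbar_has_sup _ _ _ cn)|exists e].
Qed.

Let fbar_lub s t r M : closed_cone s t r ->
  (forall e, 0 < e -> f (s + e) (t + e) r <= M) -> fbar s t r <= M.
Proof.
move=> cn h; apply: ge_sup; first by case: (fbar_has_sup _ _ _ cn).
by move=> _ [e /= e0 <-]; exact: h.
Qed.

Lemma fbar_ge0 s t r : closed_cone s t r -> 0 <= fbar s t r.
Proof.
move=> cn; apply: le_trans (fbar_ge _ _ _ _ cn ltr01).
exact/f_ge0/cone_shift.
Qed.

Lemma fbar_le s t r : closed_cone s t r -> fbar s t r <= C * s.
Proof. by move=> cn; apply: fbar_lub => // e; exact: f_shift_le. Qed.

Lemma fbar_subadd s t r s' t' r' : closed_cone s t r -> closed_cone s' t' r' ->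
  fbar (s + s') (t + t') (r + r') <= fbar s t r + fbar s' t' r'.
Proof.
move=> cn cn'; apply: fbar_lub => [|e e0].
  by move: cn cn' => [? ? ?] [? ? ?]; split; lra.
have e2 : 0 < e / 2 by rewrite divr_gt0.
have := f_subadd _ _ _ _ _ _ (cone_shift _ _ _ _ cn e2) (cone_shift _ _ _ _ cn' e2).
rewrite addrACA -splitr [t + _ + _]addrACA -splitr => h; apply: le_trans h _.
by apply: lerD; exact: fbar_ge.
Qed.

Let closed_cone_scale c s t r : 0 < c -> closed_cone s t r ->
  closed_cone (c * s) (c * t) (c * r).
Proof. by move=> c0 [s0 t0 rs]; split; rewrite ?mulr_ge0 ?ler_pM2l // ltW. Qed.

Lemma fbar_scale c s t r : 0 < c -> closed_cone s t r ->
  fbar (c * s) (c * t) (c * r) <= c * fbar s t r.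
Proof.
move=> c0 cn; apply: fbar_lub => [|e e0]; first exact: closed_cone_scale.
have ec : 0 < e / c by rewrite divr_gt0.
have {1 2}-> : e = c * (e / c) by rewrite mulrCA divff ?mulr1 // gt_eqF.
by rewrite -!mulrDr f_scale ?ler_pM2l ?fbar_ge //; exact: cone_shift.
Qed.

Lemma fbar_convex c s t r s' t' r' : 0 < c < 1 ->
  closed_cone s t r -> closed_cone s' t' r' ->
  fbar (c * s + (1 - c) * s') (c * t + (1 - c) * t') (c * r + (1 - c) * r') <=
  c * fbar s t r + (1 - c) * fbar s' t' r'.
Proof.
move=> /andP[c0 c1] cn cn'; rewrite -subr_gt0 in c1.
apply: le_trans (fbar_subadd _ _ _ _ _ _ _ _) _; first exact: closed_cone_scale.
  exact: closed_cone_scale.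
by apply: lerD; exact: fbar_scale.
Qed.

(** Subadditivity along [x = (1 - q) * x' + (x - (1 - q) * x')], where the
    last term has small first coordinate when [q] is small and [x] is close
    to [x']. *)
Let f_absorb q s t r s' t' r' : 0 < q < 1 -> cone s' t' r' ->
  cone (s - (1 - q) * s') (t - (1 - q) * t') (r - (1 - q) * r') ->
  f s t r <= f s' t' r' + C * (s - (1 - q) * s').
Proof.
move=> /andP[q0 q1] cn cnd; have q1' : 0 < 1 - q by rewrite subr_gt0.
have := f_subadd _ _ _ _ _ _ (cone_scale _ _ _ _ q1' cn) cnd.
rewrite !(addrC ((1 - q) * _)) !subrK => h; apply: le_trans h _.
by rewrite lerD ?f_le // f_scale // ler_piMl ?f_ge0 //; lra.
Qed.

Let fbar_absorb q s t r s' t' r' : 0 < q < 1 -> closed_cone s' t' r' ->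
  closed_cone (s - (1 - q) * s') (t - (1 - q) * t') (r - (1 - q) * r') ->
  fbar s t r <= fbar s' t' r' + C * (s - (1 - q) * s').
Proof.
move=> /andP[q0 q1] cn cnd; have q1' : 0 < 1 - q by rewrite subr_gt0.
have := fbar_subadd _ _ _ _ _ _ (closed_cone_scale _ _ _ _ q1' cn) cnd.
rewrite !(addrC ((1 - q) * _)) !subrK => h; apply: le_trans h _.
rewrite lerD ?fbar_le //; apply: le_trans (fbar_scale _ _ _ _ q1' cn) _.
by rewrite ler_piMl ?fbar_ge0 //; lra.
Qed.

Lemma fbar_interior s t r : 0 < s -> 0 < t -> r < s -> fbar s t r = f s t r.
Proof.
move=> s0 t0 rs; have cn : cone s t r by split; rewrite ?ltW.
have ccn : closed_cone s t r by split; rewrite ltW.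
apply/eqP; rewrite eq_le; apply/andP; split.
  by apply: fbar_lub => // e e0; apply: f_mono => //; lra.
apply/ler_addgt0Pl => d d0; rewrite addrC.
pose q := d / (d + C * s).
have Cs0 : 0 < C * s by rewrite mulr_gt0.
have q0 : 0 < q by rewrite divr_gt0 // addr_gt0.
have q1 : q < 1 by rewrite ltr_pdivrMr ?addr_gt0 // mul1r ltrDl.
have qd : C * s * q <= d.
  by rewrite /q mulrA ler_pdivrMr ?addr_gt0 //; have := mulr_ge0 (ltW d0) (ltW d0); lra.
(* This size of the shift keeps [x - (1 - q) * (x + e * (1, 1, 0))] in the cone. *)
pose e := q * Num.min (Num.min s t) (s - r).
have m0 : 0 < Num.min (Num.min s t) (s - r) by rewrite !lt_min s0 t0 subr_gt0 rs.
have e0 : 0 < e by rewrite mulr_gt0.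
have es : e <= q * s by rewrite ler_pM2l // !ge_min lexx.
have et : e <= q * t by rewrite ler_pM2l // !ge_min lexx orbT.
have er : e <= q * (s - r) by rewrite ler_pM2l // !ge_min lexx !orbT.
have qe : 0 < q * e by rewrite mulr_gt0.
have qe1 : q * e <= e by rewrite ler_piMl // ltW.
apply: le_trans (f_absorb q _ _ _ _ _ _ _ (cone_shift _ _ _ _ ccn e0) _) _.
- by rewrite q0.
- by split; lra.
apply: lerD; first exact: fbar_ge.
apply: le_trans qd; rewrite -mulrA ler_pM2l //; lra.
Qed.

Let sub_scaled_near (a q : R) : 0 <= a -> 0 < q -> exists2 d, 0 < d &
  forall b, 0 <= b -> `|b - a| < d -> 0 <= b - (1 - q) * a.
Proof.
move=> a0 q0; have [->|a0'] := eqVneq a 0.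
  by exists 1 => // b b0 _; rewrite mulr0 subr0.
have a1 : 0 < a by rewrite lt_def a0' a0.
exists (q * a); first exact: mulr_gt0.
by move=> b b0; rewrite ltr_norml => /andP[h _]; lra.
Qed.

Let exists_small (K eta : R) : 0 < K -> 0 < eta -> exists2 q, 0 < q < 1 & K * q <= eta.
Proof.
move=> K0 eta0; exists (eta / (eta + K)).
  by rewrite divr_gt0 ?addr_gt0 //= ltr_pdivrMr ?addr_gt0 // mul1r ltrDl.
rewrite mulrA ler_pdivrMr ?addr_gt0 //.
by have := mulr_ge0 (ltW eta0) (ltW eta0); lra.
Qed.

(** [fbar_absorb] with the fixed point in the role of [x'], which is where
    the polyhedral shape of the cone is used. *)
Let fbar_usc s t r (eta : R) : closed_cone s t r -> 0 < eta -> exists2 d, 0 < d &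
  forall s' t' r', closed_cone s' t' r' ->
    `|s' - s| < d -> `|t' - t| < d -> `|r' - r| < d ->
    fbar s' t' r' <= fbar s t r + eta.
Proof.
move=> cn eta0; have [s0 t0 rs] := cn.
have K0 : 0 < C * (s + 1) by rewrite mulr_gt0 // ltr_wpDl.
have [q q01 qK] := exists_small _ _ K0 eta0; have /andP[q0 q1] := q01.
have [d1 d10 h1] := sub_scaled_near s q s0 q0.
have [d2 d20 h2] := sub_scaled_near t q t0 q0.
have [|d3 d30 h3] := sub_scaled_near (s - r) q _ q0; first by rewrite subr_ge0.
pose d := Num.min (Num.min d1 d2) (Num.min (d3 / 2) q).
exists d; first by rewrite !lt_min d10 d20 divr_gt0.
have dd1 : d <= d1 by rewrite !ge_min lexx.
have dd2 : d <= d2 by rewrite !ge_min lexx orbT.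
have dd3 : d <= d3 / 2 by rewrite !ge_min lexx !orbT.
have dq : d <= q by rewrite !ge_min lexx !orbT.
move=> s' t' r' cn' ls lt lr; have [s'0 t'0 rs'] := cn'.
have k1 := h1 s' s'0 (lt_le_trans ls dd1).
have k2 := h2 t' t'0 (lt_le_trans lt dd2).
have k3 : 0 <= s' - r' - (1 - q) * (s - r).
  apply: h3; first by rewrite subr_ge0.
  by move: ls lr; rewrite !ltr_norml => /andP[? ?] /andP[? ?]; apply/andP; split; lra.
have cnd : closed_cone (s' - (1 - q) * s) (t' - (1 - q) * t) (r' - (1 - q) * r).
  by split=> //; lra.
apply: le_trans (fbar_absorb q _ _ _ _ _ _ q01 cn cnd) _.
rewrite lerD2l; apply: le_trans qK; rewrite -mulrA ler_pM2l //.
by move: ls; rewrite ltr_norml => /andP[? ?]; lra.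
Qed.

(** [f_absorb] at points shifted into the open cone, with the moving point in
    the role of [x']; the shift is chosen so as to nearly attain the supremum
    defining [fbar] at the fixed point. *)
Let fbar_lsc s t r (eta : R) : closed_cone s t r -> 0 < eta -> exists2 d, 0 < d &
  forall s' t' r', closed_cone s' t' r' ->
    `|s' - s| < d -> `|t' - t| < d -> `|r' - r| < d ->
    fbar s t r <= fbar s' t' r' + eta.
Proof.
move=> cn eta0; have [s0 t0 rs] := cn.
have eta2 : 0 < eta / 2 by rewrite divr_gt0.
have [_ [e /= e0 <-] fe] := sup_adherent eta2 (fbar_has_sup _ _ _ cn).
have K0 : 0 < C * (s + e + 2) by rewrite mulr_gt0 //; lra.
have [q q01 qK] := exists_small _ _ K0 eta2; have /andP[q0 q1] := q01.
have qe : 0 < q * e by rewrite mulr_gt0.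
pose d := Num.min (q * e / 2) q.
have dqe : d <= q * e / 2 by rewrite ge_min lexx.
have dq : d <= q by rewrite ge_min lexx orbT.
exists d; first by rewrite lt_min divr_gt0.
move=> s' t' r' cn' ls lt lr; have [s'0 t'0 rs'] := cn'.
have qs : 0 <= q * s' by rewrite mulr_ge0 // ltW.
have qt : 0 <= q * t' by rewrite mulr_ge0 // ltW.
have qr : 0 <= q * (s' - r') by rewrite mulr_ge0 ?subr_ge0 // ltW.
move: ls lt lr; rewrite !ltr_norml => /andP[? ls] /andP[? ?] /andP[? ?].
have qls : q * s' <= q * s + q.
  by rewrite -[X in _ + X]mulr1 -mulrDr ler_pM2l //; lra.
have cnd : cone (s + e - (1 - q) * (s' + e)) (t + e - (1 - q) * (t' + e)) (r - (1 - q) * r').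
  by split; lra.
have := f_absorb q _ _ _ _ _ _ q01 (cone_shift _ _ _ _ cn' e0) cnd.
have := fbar_ge _ _ _ _ cn' e0.
have : C * (s + e - (1 - q) * (s' + e)) <= eta / 2.
  by apply: le_trans qK; rewrite -mulrA ler_pM2l //; lra.
by move: fe; rewrite -/(fbar s t r); lra.
Qed.

Lemma fbar_continuous s t r (eta : R) : closed_cone s t r -> 0 < eta ->
  exists2 d, 0 < d & forall s' t' r', closed_cone s' t' r' ->
    `|s' - s| < d -> `|t' - t| < d -> `|r' - r| < d ->
    `|fbar s' t' r' - fbar s t r| <= eta.
Proof.
move=> cn eta0; have [d1 d10 h1] := fbar_usc _ _ _ _ cn eta0.
have [d2 d20 h2] := fbar_lsc _ _ _ _ cn eta0.
exists (Num.min d1 d2); first by rewrite lt_min d10.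
move=> s' t' r' cn'; rewrite !lt_min => /andP[a1 a2] /andP[b1 b2] /andP[c1 c2].
rewrite ler_norml lerBrDr addrC lerBlDr -lerBlDl.
have := h1 _ _ _ cn' a1 b1 c1; have := h2 _ _ _ cn' a2 b2 c2.
by move=> ? ?; apply/andP; split; lra.
Qed.

End Extension.

(** * Positivity above the law of large numbers limit *)

(** The function [gpp] is the infimum over [u] of
    [s * u + t * (p * (1 - u) / (u - p))], the mean growth of the stationary
    queue with parameter [u]: Bernoulli increments of mean [u] per column and
    geometric ones of mean [p * (1 - u) / (u - p)] per row.  For
    [0 < t < s * (1 - p) / p] the infimum is attained inside [(p, 1)].
    For larger [t] there is nothing to prove, since then [gpp] equals [s]. *)
Lemma gpp_parameter (R : realType) (p s t r : R) : 0 < p -> p < 1 ->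
  0 <= t -> r <= s -> gpp p s t < r ->
  exists2 u, p < u < 1 & s * u + t * (p * (1 - u) / (u - p)) < r.
Proof.
move=> p0 p1 t0 rs; rewrite /gpp; case: ifPn => [tlt gr|_ sr]; last first.
  by have := lt_le_trans sr rs; rewrite ltxx.
have s0 : 0 < s.
  by rewrite -(@pmulr_lgt0 _ ((1 - p) / p)) ?divr_gt0 ?subr_gt0 // (le_lt_trans t0).
have tlt' : p * t < (1 - p) * s.
  by move: tlt; rewrite mulrA ltr_pdivlMr // mulrC [s * _]mulrC.
pose a := Num.sqrt (p * s); pose b := Num.sqrt ((1 - p) * t).
have a0 : 0 < a by rewrite sqrtr_gt0 mulr_gt0.
have aa : a ^+ 2 = p * s by rewrite sqr_sqrtr // mulr_ge0 // ltW.
have bb : b ^+ 2 = (1 - p) * t by rewrite sqr_sqrtr // mulr_ge0 // subr_ge0 ltW.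
(* For t = 0 the infimum is approached at the excluded endpoint u = p. *)
have [t00|tn0] := eqVneq t 0.
  have gE : p * s < r.
    by move: gr; rewrite t00 mulr0 sqrtr0 addr0 subr0 -/a aa.
  have rs1 : r / s <= 1 by rewrite ler_pdivrMr // mul1r.
  have prs : p < r / s by rewrite ltr_pdivlMr.
  exists ((p + r / s) / 2); first by apply/andP; split; lra.
  rewrite t00 mul0r addr0 (_ : s * _ = (p * s + s * (r / s)) / 2); last by ring.
  rewrite (_ : s * (r / s) = r); last by field; rewrite gt_eqF.
  by lra.
have t1 : 0 < t by rewrite lt_def tn0 t0.
have b0 : 0 < b by rewrite sqrtr_gt0 mulr_gt0 // subr_gt0.
have pba : p * b < (1 - p) * a.
  rewrite -(@ltr_pXn2r _ 2) ?nnegrE ?mulr_ge0 ?subr_ge0 ?(ltW b0) ?(ltW a0) ?(ltW p0) ?(ltW p1) //.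
  rewrite !exprMn aa bb.
  have q0 : 0 < p * (1 - p) by rewrite mulr_gt0 // subr_gt0.
  have h : p * (1 - p) * (p * t) < p * (1 - p) * ((1 - p) * s) by rewrite ltr_pM2l.
  by move: h; lra.
(* The critical point: (u - p) ^+ 2 = t * p * (1 - p) / s. *)
exists (p + p * b / a).
  rewrite ltrDl divr_gt0 ?mulr_gt0 //= -ltrBrDl ltr_pdivrMr //.
have -> : p + p * b / a - p = p * b / a by ring.
have -> : s * (p + p * b / a) + t * (p * (1 - (p + p * b / a)) / (p * b / a)) =
    p * s + (p * s) * b / a + ((1 - p) * t) * a / b - p * t.
  by field; rewrite !gt_eqF.
rewrite -aa -bb (_ : _ - p * t = (a + b) ^+ 2 - t) //.
have -> : p * t = t - b ^+ 2 by rewrite bb; ring.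
by field; rewrite !gt_eqF.
Qed.

Section Positivity.
Context {R : realType} {d : measure_display} {T : measurableType d}.
Variables (P : probability T R) (p : R) (om : nat * nat -> {RV P >-> bool}).
Hypothesis p_gt0 : 0 < p.
Hypothesis p_lt1 : p < 1.
Hypothesis indep : mutually_independent P om.
Hypothesis law : forall v, P [set x | om v x = true] = p%:E.
Implicit Types (s t r : R).

Lemma ln_tail_le m n (y : R) : y <= m%:R -> - ln (tail P om m n y) <= - ln p * m%:R.
Proof.
move=> ym; have tg := tail_ge P p om p_gt0 indep law m n y ym.
rewrite mulNr lerN2 mulr_natr -lnXn // ler_ln ?posrE ?exprn_gt0 //.
by apply: lt_le_trans tg; rewrite exprn_gt0.
Qed.

Lemma rate_cvg_tail s t r : cone s t r ->
  (fun N => cost (tail P om) (N%:R * s) (N%:R * t) (N%:R * r) / N%:R) @ \oo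
    --> rate (tail P om) s t r.
Proof.
apply: (rate_cvg (tail P om) (- ln p)).
- exact: (tail_gt0 P p om p_gt0 indep law).
- exact: (tail_le1 P p om indep law).
- exact: (le_tail P p om indep law).
- exact: (tail_supermul P p om indep law).
- exact: ln_tail_le.
- by rewrite oppr_ge0 ln_le0 // ltW.
Qed.

(** The logarithm of [tail_chernoff] is linear in [m], [n] and the threshold.
    To first order in [z - 1] its coefficients are the stationary means and the
    threshold, so the assumed gap makes the exponent negative for [z] slightly
    above 1. *)
Lemma rate_gt0 s t r u : cone s t r -> p < u < 1 ->
  s * u + t * (p * (1 - u) / (u - p)) < r -> 0 < rate (tail P om) s t r.
Proof.
move=> cn pu; have [s0 t0 rs] := cn; have /andP[pu0 u1] := pu.
set c := p * (1 - u) / (u - p) => gap.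
have u0 : 0 < u by exact: lt_trans pu0.
have c0 : 0 <= c by rewrite divr_ge0 ?mulr_ge0 ?subr_ge0 // ltW.
have su0 : 0 <= s * u by rewrite mulr_ge0 // ltW.
have tc0 : 0 <= t * c by rewrite mulr_ge0.
pose g := r - (s * u + t * c).
have g0 : 0 < g by rewrite subr_gt0.
(* Chosen such that s * u * z is still below r - t * c. *)
pose z := 1 + g / (s * u + 1).
have z1 : 1 < z by rewrite ltrDl divr_gt0 // ltr_wpDl.
have z0 : 0 < z by exact: lt_trans z1.
have suz : s * u * z < r - t * c.
  have : s * u * (g / (s * u + 1)) < g.
    rewrite mulrA ltr_pdivrMr ?ltr_wpDl // mulrC; have := g0; lra.
  by rewrite /z /g; lra.
pose lam := ln z.
have lam0 : 0 <= lam by rewrite ln_ge0 // ltW.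
have elam : expR lam = z by rewrite lnK.
have zi1 : z^-1 < 1 by rewrite invf_lt1.
have lam_ge : 1 - z^-1 <= lam.
  have : ln (1 + (z^-1 - 1)) <= z^-1 - 1.
    by rewrite le_ln1Dx // ltrBrDl subrr invr_gt0.
  by rewrite addrCA subrr addr0 lnV ?posrE // -/lam; lra.
pose a := c * (1 - z^-1); pose b := u * (z - 1).
have a0 : 0 <= a by rewrite mulr_ge0 // subr_ge0 ltW.
pose D := lam * r - t * a - s * b.
have r0 : 0 < r by apply: le_lt_trans gap; rewrite addr_ge0.
have D0 : 0 < D.
  have h1 : (1 - z^-1) * r <= lam * r by rewrite ler_wpM2r // ltW.
  have h2 : s * b = (1 - z^-1) * (s * u * z).
    by rewrite /b; field; rewrite gt_eqF.
  have h3 : (1 - z^-1) * (s * u * z) < (1 - z^-1) * (r - t * c).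
    by rewrite ltr_pM2l // subr_gt0.
  by rewrite /D /a h2; move: h1 h3; lra.
suff : D / 2 <= rate (tail P om) s t r by apply: lt_le_trans; rewrite divr_gt0.
have okN := threshold_le_truncn_near _ _ _ cn.
apply: cvgr_to_ge (rate_cvg_tail _ _ _ cn) _; near=> N.
have N0 : 0 < N%:R :> R by rewrite ltr0n; near: N; exact: nbhs_infty_gt.
have aN : 2 * a / D <= N%:R by near: N; exact: nbhs_infty_ger.
have oN : N%:R * r <= (Num.truncn (N%:R * s))%:R by near: N.
rewrite ler_pdivlMr //.
set m := Num.truncn (N%:R * s) in oN *; set n := Num.truncn (N%:R * t).
have mE : m%:R <= N%:R * s by rewrite truncn_le mulr_ge0.
have nE : n%:R <= N%:R * t by rewrite truncn_le mulr_ge0.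
pose rho := p * (1 - u) / (u * (1 - p)).
have := tail_chernoff P p om p_gt0 p_lt1 indep law m n (N%:R * r) u rho lam pu lam0 erefl.
(* The ratio rho / (1 - rho), the mean of the geometric law, equals c. *)
have AE : (1 - rho / expR lam) / (1 - rho) = 1 + a.
  have up : u - p != 0 by rewrite gt_eqF // subr_gt0.
  have u1p : u * (1 - p) != 0 by rewrite gt_eqF // mulr_gt0 // subr_gt0.
  have e1 : 1 - rho = (u - p) / (u * (1 - p)).
    rewrite /rho -[X in X - _](divff u1p) -mulrBl; congr (_ / _); ring.
  have e2 : rho / (1 - rho) = c.
    by rewrite e1 /rho /c invf_div mulrA divfK.
  rewrite elam /a -e2; field.
  by rewrite e1 (gt_eqF z0) mulf_neq0 ?invr_neq0.
rewrite AE elam (_ : 1 - u + u * z = 1 + b); last by rewrite /b; ring.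
have b0 : 0 <= b by rewrite mulr_ge0 ?subr_ge0 // ltW.
have t0' := tail_gt0 P p om p_gt0 indep law m n (N%:R * r) oN.
rewrite -ler_ln ?posrE ?mulr_gt0 ?expR_gt0 ?exprn_gt0 ?ltr_wpDr //.
rewrite !lnM ?posrE ?expR_gt0 ?exprn_gt0 ?ltr_wpDr // expRK !lnXn ?ltr_wpDr // => h.
have la : ln (1 + a) <= a by rewrite le_ln1Dx // (lt_le_trans _ a0) // ltrN10.
have lb : ln (1 + b) <= b by rewrite le_ln1Dx // (lt_le_trans _ b0) // ltrN10.
have la' : ln (1 + a) *+ n.+1 <= N%:R * t * a + a.
  rewrite -[ln _ *+ _]mulr_natl -natr1 mulrDl mul1r lerD //.
  by apply: ler_pM => //; rewrite ln_ge0 // lerDl.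
have lb' : ln (1 + b) *+ m <= N%:R * s * b.
  by rewrite -[ln _ *+ _]mulr_natl; apply: ler_pM => //; rewrite ln_ge0 // lerDl.
rewrite /cost -/m -/n.
have aN' : a <= D / 2 * N%:R by move: aN; rewrite ler_pdivrMr //; lra.
have DE : D * N%:R = lam * (N%:R * r) - N%:R * t * a - N%:R * s * b by rewrite /D; ring.
by move: h la' lb' aN' DE; lra.
Unshelve. all: by end_near. Qed.

End Positivity.

(** * The domain and its topology *)

Section RateDomain.
Context {R : realType}.
Local Notation E := (R^o * R^o * R^o)%type.
Implicit Types (x y : E) (s t r : R).

Lemma ball_coords x y (e : R) :
  ball x e y <-> [/\ `|y.1.1 - x.1.1| < e, `|y.1.2 - x.1.2| < e & `|y.2 - x.2| < e].
Proof.
split=> [[[b1 b2] b3]|[b1 b2 b3]].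
  by split; rewrite distrC.
by split; [split|]; rewrite /ball /= distrC.
Qed.

Lemma rate_domainP x : rate_domain R x <-> [/\ 0 <= x.2, x.2 <= x.1.1 & 0 <= x.1.2].
Proof.
rewrite /rate_domain /= ge_max; split=> [[/andP[? ?] [? ?]]|[? rs ?]] //.
by split=> //; rewrite rs (le_trans _ rs).
Qed.

Lemma closure_rate_domain : closure (rate_domain R) = rate_domain R.
Proof.
apply/seteqP; split=> x; last exact: subset_closure.
move=> clx; have near_dom e : 0 < e -> exists y, [/\ 0 <= y.2, y.2 <= y.1.1,
    0 <= y.1.2 & ball x e y].
  move=> e0; have [y [/rate_domainP[? ? ?] bxy]] := clx _ (nbhsx_ballx x e e0).
  by exists y; split.
apply/rate_domainP; split; apply/ler_addgt0Pl => e e0.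
- have [y [? ? ? /ball_coords[]]] := near_dom e e0.
  by rewrite !ltr_norml => /andP[? ?] /andP[? ?] /andP[? ?]; lra.
- have e2 : 0 < e / 2 by rewrite divr_gt0.
  have [y [? ? ? /ball_coords[]]] := near_dom _ e2.
  by rewrite !ltr_norml => /andP[? ?] /andP[? ?] /andP[? ?]; lra.
- have [y [? ? ? /ball_coords[]]] := near_dom e e0.
  by rewrite !ltr_norml => /andP[? ?] /andP[? ?] /andP[? ?]; lra.
Qed.

Lemma interior_rate_domain x :
  (rate_domain R)° x <-> [/\ 0 < x.2, x.2 < x.1.1 & 0 < x.1.2].
Proof.
split.
  move=> /nbhs_ballP[e /= e0 sub].
  have dom s t r : `|s - x.1.1| < e -> `|t - x.1.2| < e -> `|r - x.2| < e ->
      [/\ 0 <= r, r <= s & 0 <= t].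
    by move=> *; apply/(rate_domainP ((s, t), r))/sub/ball_coords.
  have e2 : `|- (e / 2)| < e by rewrite normrN ger0_norm; lra.
  have e3 : `|0 : R| < e by rewrite normr0.
  have [|||a1 a2 a3] := dom (x.1.1 - e / 2) (x.1.2 - e / 2) x.2;
    rewrite ?subrr // ?[_ - e / 2]addrC ?addrK //.
  have [|||b1 b2 b3] := dom x.1.1 x.1.2 (x.2 - e / 2);
    rewrite ?subrr // ?[_ - e / 2]addrC ?addrK //.
  by split; lra.
move=> [r0 rs t0]; apply/nbhs_ballP.
pose e := Num.min (Num.min x.2 x.1.2) ((x.1.1 - x.2) / 2).
have e1 : e <= x.2 by rewrite !ge_min lexx.
have e2 : e <= x.1.2 by rewrite !ge_min lexx orbT.
have e3 : e <= (x.1.1 - x.2) / 2 by rewrite !ge_min lexx !orbT.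
exists e => /=; first by rewrite !lt_min r0 t0 divr_gt0 // subr_gt0.
move=> y /ball_coords[]; rewrite !ltr_norml => /andP[? ?] /andP[? ?] /andP[? ?].
by apply/rate_domainP; split; lra.
Qed.

Lemma interior_dense_rate_domain x (e : R) : rate_domain R x -> 0 < e ->
  exists2 y, (rate_domain R)° y & ball x e y.
Proof.
move=> /rate_domainP[r0 rs t0] e0.
exists ((x.1.1 + e / 2, x.1.2 + e / 4), x.2 + e / 4).
  by apply/interior_rate_domain; split=> /=; lra.
apply/ball_coords => /=.
have e2 : `|e / 2| < e by rewrite ger0_norm; lra.
have e4 : `|e / 4| < e by rewrite ger0_norm; lra.
by rewrite ![_ + e / _]addrC !addrK.
Qed.

Lemma within_continuous_coords (D : set E) (g : E -> R^o) :
  (forall x (eta : R), D x -> 0 < eta -> exists2 d, 0 < d & forall y, D y ->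
     `|y.1.1 - x.1.1| < d -> `|y.1.2 - x.1.2| < d -> `|y.2 - x.2| < d ->
     `|g y - g x| <= eta) ->
  {within D, continuous g}.
Proof.
move=> h; apply/subspace_continuousP => x Dx; apply/cvgrPdist_le => eta eta0.
have [d d0 hd] := h x eta Dx eta0.
apply/nbhs_ballP; exists d => //= y /ball_coords[b1 b2 b3] Dy.
by rewrite distrC; exact: hd.
Qed.

Lemma eq_continuous_closure (g h : E -> R^o) :
  {within closure (rate_domain R), continuous g} ->
  {within closure (rate_domain R), continuous h} ->
  (forall x, (rate_domain R)° x -> g x = h x) ->
  forall x, closure (rate_domain R) x -> g x = h x.
Proof.
move=> /subspace_continuousP cg /subspace_continuousP ch gh x clx.
apply/eqP; rewrite -subr_eq0 -normr_le0; apply/ler_addgt0Pl => e e0.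
have e2 : 0 < e / 2 by rewrite divr_gt0.
have /cvgrPdist_le /(_ _ e2) ng := cg x clx.
have /cvgrPdist_le /(_ _ e2) nh := ch x clx.
pose S : set E := fun y => closure (rate_domain R) y ->
  `|g x - g y| <= e / 2 /\ `|h x - h y| <= e / 2.
have nS : nbhs x S by exact: filterI ng nh.
have [d /= d0 hd] := (nbhs_ballP x S).1 nS.
rewrite closure_rate_domain in clx.
have [y iy bxy] := interior_dense_rate_domain _ _ clx d0.
have cly : closure (rate_domain R) y by apply: subset_closure; exact: interior_subset iy.
have [g1 h1] := hd y bxy cly; rewrite (gh y iy) in g1.
rewrite addr0 (_ : g x - h x = (g x - h y) - (h x - h y)); last by ring.
by apply: le_trans (ler_normB _ _) _; rewrite [leRHS]splitr lerD.
Qed.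

(** At the endpoints of the unit interval a convex combination is one of the
    two points, so only weights strictly between 0 and 1 need the hypothesis;
    this matters because homogeneity is available for positive factors only. *)
Lemma convex_function_coords (D : set E) (g : E -> R^o) :
  (forall (c : R) x y, 0 < c < 1 -> D x -> D y ->
     g ((c * x.1.1 + (1 - c) * y.1.1, c * x.1.2 + (1 - c) * y.1.2),
        c * x.2 + (1 - c) * y.2) <= c * g x + (1 - c) * g y) ->
  convex_function D g.
Proof.
move=> h c x y; rewrite !inE => Dx Dy.
have [c0|c0] := eqVneq (c%:num : R) 0.
  by rewrite (_ : c = 0%:i01) ?conv0 //; exact: val_inj.
have [c1|c1] := eqVneq (c%:num : R) 1.
  by rewrite (_ : c = 1%:i01) ?conv1 //; exact: val_inj.
have c01 : 0 < (c%:num : R) < 1.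
  by rewrite !lt_def c0 eq_sym c1 /= ge0 le1.
have := h _ x y c01 Dx Dy; apply.
Qed.

End RateDomain.

(** * The theorem *)

Theorem theorem3p1 (R : realType) (d : measure_display) (T : measurableType d)
    (P : probability T R) (p : R) (om : nat * nat -> {RV P >-> bool}) :
  0 < p -> p < 1 ->
  mutually_independent P om ->
  (forall v, P [set x | om v x = true] = p%:E) ->
  exists J : R^o * R^o * R^o -> R^o,
    [/\ forall s t r : R, 0 <= r -> r < s -> 0 <= t ->
          0 <= J ((s, t), r) /\
          (fun N : nat => - (((N%:R : R)^-1)%:E *
             lne (P [set x | (N%:R * r <=
                       last_passage R (fun v => om v x) (0%N, 0%N)
                         (Num.truncn (N%:R * s), Num.truncn (N%:R * t)))%R])))%E
            @ \oo --> (J ((s, t), r))%:E,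
        {within (rate_domain R)°, continuous J},
        convex_function (rate_domain R)° J,
        forall s t r : R, 0 <= r -> r < s -> 0 <= t ->
          gpp p s t < r -> 0 < J ((s, t), r)
      & exists2 Jbar : R^o * R^o * R^o -> R^o,
          convex_extension (rate_domain R) J Jbar &
          (forall K, convex_extension (rate_domain R) J K ->
             forall x, closure (rate_domain R) x -> K x = Jbar x) /\
          (forall s t r : R, closure (rate_domain R) ((s, t), r) ->
             gpp p s t < r -> 0 < Jbar ((s, t), r))].
Proof.
move=> p0 p1 indep law.
pose C := - ln p; pose tl := tail P om.
have C0 : 0 < C by rewrite oppr_gt0 ln_lt0 // p0.
have tl_gt0 := tail_gt0 P p om p0 indep law.
have tl_le1 := tail_le1 P p om indep law.
have le_tl := le_tail P p om indep law.
have tl_mul := tail_supermul P p om indep law.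
have tl_low := ln_tail_le P p om p0 indep law.
pose f := rate tl.
have f_ge0 := rate_ge0 tl C tl_gt0 tl_le1 le_tl tl_mul tl_low (ltW C0).
have f_le := rate_le tl C tl_gt0 tl_le1 le_tl tl_mul tl_low (ltW C0).
have f_mono := rate_mono tl C tl_gt0 tl_le1 le_tl tl_mul tl_low (ltW C0).
have f_sub := rate_subadd tl C tl_gt0 tl_le1 le_tl tl_mul tl_low (ltW C0).
have f_scale := rate_scale tl C tl_gt0 tl_le1 le_tl tl_mul tl_low (ltW C0).
have f_gt0 := rate_gt0 P p om p0 p1 indep law.
pose E := (R^o * R^o * R^o)%type.
pose J : E -> R^o := fun x => f x.1.1 x.1.2 x.2.
pose Jbar : E -> R^o := fun x => fbar f x.1.1 x.1.2 x.2.
have int_cone (x : E) : (rate_domain R)° x -> cone x.1.1 x.1.2 x.2.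
  by move=> /interior_rate_domain[? ? ?]; split; lra.
have dom_cone (x : E) : rate_domain R x -> closed_cone x.1.1 x.1.2 x.2.
  by move=> /rate_domainP[? ? ?]; split; lra.
have JbarE (x : E) : (rate_domain R)° x -> Jbar x = J x.
  move=> /interior_rate_domain[? ? ?].
  by apply: (fbar_interior f C C0 f_ge0 f_le f_mono f_sub f_scale) => //; lra.
have cJbar : {within closure (rate_domain R), continuous Jbar}.
  apply: within_continuous_coords => x eta.
  rewrite closure_rate_domain => /dom_cone cx eta0.
  have [e e0 he] := fbar_continuous f C C0 f_ge0 f_le f_mono f_sub f_scale _ _ _ _ cx eta0.
  by exists e => // y /dom_cone cy; exact: he.
have ext : convex_extension (rate_domain R) J Jbar.
  split=> //; rewrite closure_rate_domain; apply: convex_function_coords.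
  move=> c x y c01 /dom_cone cx /dom_cone cy.
  exact: (fbar_convex f C C0 f_le f_mono f_sub f_scale).
exists J; split.
- move=> s t r r0 rs t0.
  have cn : cone s t r by split => //; lra.
  split; first exact: f_ge0.
  have bounded := threshold_le_truncn_near s t r cn.
  have cv := rate_cvg_tail P p om p0 p1 indep law s t r cn.
  have gE : \forall N \near \oo, (- ((N%:R^-1)%:E *
      lne (P [set x | (N%:R * r <= last_passage R (fun v => om v x) (0%N, 0%N)
        (Num.truncn (N%:R * s), Num.truncn (N%:R * t)))%R])))%E =
      (cost tl (N%:R * s) (N%:R * t) (N%:R * r) / N%:R)%:E.
    near=> N.
    have -> : [set x | (N%:R * r <= last_passage R (fun v => om v x) (0%N, 0%N)
        (Num.truncn (N%:R * s), Num.truncn (N%:R * t)))%R] =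
      [set x | N%:R * r <= (lpp (fun v => om v x) (Num.truncn (N%:R * s))
        (Num.truncn (N%:R * t)))%:R].
      by apply/seteqP; split=> x /=; rewrite last_passage_lpp.
    rewrite (tailE P p om indep law) lne_EFin; last by apply: tl_gt0; near: N.
    by rewrite -EFinM -EFinN /cost mulNr mulrC.
  apply: cvg_EFin; first by near=> N; rewrite (near gE N).
  by apply: cvg_trans cv; apply: near_eq_cvg; near=> N; rewrite /= (near gE N).
- apply: (@subspace_eq_continuous _ _ _ Jbar).
    by move=> x; rewrite inE => /JbarE.
  apply: continuous_subspaceW cJbar.
  by apply: subset_trans (@interior_subset _ _) (@subset_closure _ _).
- apply: convex_function_coords => c x y /andP[c0 c1] /int_cone cx /int_cone cy.
  have c1' : 0 < 1 - c by rewrite subr_gt0.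
  apply: le_trans (f_sub _ _ _ _ _ _ (cone_scale _ _ _ _ c0 cx) (cone_scale _ _ _ _ c1' cy)) _.
  by rewrite !f_scale.
- move=> s t r r0 rs t0 gr.
  have [u pu ur] := gpp_parameter R p s t r p0 p1 t0 (ltW rs) gr.
  by apply: f_gt0 pu ur; split => //; lra.
exists Jbar => //; split.
  move=> K [KJ cK _]; apply: eq_continuous_closure cK cJbar _ => x ix.
  by rewrite KJ // JbarE.
move=> s t r; rewrite closure_rate_domain => dx gr.
have /= cx := dom_cone _ dx; have [s0 t0 rs] := cx.
have [u pu ur] := gpp_parameter R p s t r p0 p1 t0 rs gr.
set c := p * (1 - u) / (u - p) in ur.
have c0 : 0 <= c.
  by move/andP: pu => [? ?]; rewrite divr_ge0 ?mulr_ge0 ?subr_ge0 // ltW.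
have u0 : 0 < u by move/andP: pu => [? ?]; exact: lt_trans p0 _.
(* The shift by e raises s * u + t * c by half of its distance to r. *)
pose e := (r - (s * u + t * c)) / (2 * (u + c)).
have uc0 : 0 < u + c by rewrite ltr_wpDr.
have e0 : 0 < e by rewrite divr_gt0 ?subr_gt0 // mulr_gt0.
apply: lt_le_trans (fbar_ge f C C0 f_le f_mono _ _ _ _ cx e0).
apply: f_gt0 pu _; first by split => /=; lra.
rewrite -/c.
have eE : e * (u + c) = (r - (s * u + t * c)) / 2.
  by rewrite /e; field; rewrite gt_eqF.
have : (s + e) * u + (t + e) * c = s * u + t * c + e * (u + c) by ring.
move=> ->; rewrite eE; lra.
Unshelve. all: by end_near. Qed.
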